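(* Let $K$ and $L$ be origin-symmetric star bodies in $\mathbb{R}^n$, and let $1\le k<n$ be an integer. Suppose that $K$ and $L$ are generalized $k$-intersection bodies. Then $$\left|\mathrm{Vol}_n(K)^{\frac{n-k}{n}}-\mathrm{Vol}_n(L)^{\frac{n-k}{n}}\right|\le c_{n,k}\max_{H\in G(n,n-k)}\left|\mathrm{Vol}_{n-k}(K\cap H)-\mathrm{Vol}_{n-k}(L\cap H)\right|,$$ where $c_{n,k}=|B_2^n|^{(n-k)/n}/|B_2^{n-k}|$.
   Context: $|B_2^m|$ denotes the volume of the Euclidean unit ball in $\mathbb{R}^m$. $\mathrm{Vol}_m$ is $m$-dimensional Lebesgue measure (on $m$-dimensional linear subspaces, with the induced Euclidean structure). $S^{n-1}$ is the Euclidean unit sphere in $\mathbb{R}^n$. $G(n,n-k)$ is the Grassmannian of $(n-k)$-dimensional linear subspaces of $\mathbb{R}^n$. A closed bounded set $K\subset\mathbb{R}^n$ is a star body if every straight line through the origin crosses the boundary of $K$ at exactly two points different from the origin, the origin is an interior point of $K$, and the Minkowski functional $\|x\|_K=\min\{a\ge 0: x\in aK\}$ is a continuous function on $\mathbb{R}^n$. It is origin-symmetric if $K=-K$. The $(n-k)$-dimensional spherical Radon transform $\mathcal{R}_{n-k}:C(S^{n-1})\to C(G(n,n-k))$ is defined by $\mathcal{R}_{n-k}(f)(H)=\int_{S^{n-1}\cap H} f(x)\,dx$, where integration is with respect to the (unnormalized) surface measure on the unit sphere $S^{n-1}\cap H$ of $H$ (counting measure if $n-k=1$). Let $X=\mathcal{R}_{n-k}(C(S^{n-1}))\subset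 C(G(n,n-k))$, and let $M^+(X)$ be the set of linear continuous (in the sup norm) functionals $\nu$ on $X$ that are positive, i.e. $\nu(g)\ge 0$ for every non-negative $g\in X$. An origin-symmetric star body $K$ in $\mathbb{R}^n$ is a generalized $k$-intersection body if there exists $\nu\in M^+(X)$ such that for every $f\in C(S^{n-1})$, $$\int_{S^{n-1}}\|x\|_K^{-k}f(x)\,dx=\nu(\mathcal{R}_{n-k}(f)),$$ where $dx$ is the unnormalized surface measure on $S^{n-1}$. *)

(* Defs.v *)
From HB Require Import structures.
From mathcomp Require Import all_boot all_order all_algebra.
From mathcomp Require Import all_classical all_reals all_analysis.

Set Implicit Arguments.
Unset Strict Implicit.
Unset Printing Implicit Defensive.

Import Order.TTheory GRing.Theory Num.Theory.
Import numFieldNormedType.Exports.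

Local Open Scope classical_set_scope.
Local Open Scope ring_scope.

(* R^n with its Borel sigma-algebra; as a type it is 'rV[R]_n. *)
Notation borel_rV R n := (g_sigma_algebraType (@open 'rV[R]_n)).

(* Lebesgue measure on R^n, as the n-fold product of Lebesgue measure on R
   (Dirac mass on the one-point space R^0). *)
Fixpoint lebesgue_rV (R : realType) (n : nat) : set (borel_rV R n) -> \bar R :=
  match n with
  | 0%N => dirac (0 : borel_rV R 0)
  | n'.+1 =>
      pushforward (@lebesgue_measure R \x @lebesgue_rV R n')%E
        (fun p : measurableTypeR R * borel_rV R n' =>
           (row_mx (p.1 : R)%:M (p.2 : 'rV[R]_n') : borel_rV R n'.+1))
  end.
Arguments lebesgue_rV R n A : clear implicits.

(* The topology on 'rV[R]_n is the product one; its library norm is the sup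
   norm, so the Euclidean norm has to be defined. *)
Definition enorm (R : realType) (n : nat) (x : 'rV[R]_n) : R :=
  Num.sqrt (\sum_(i < n) x 0 i ^+ 2).

Definition euclidean_ball (R : realType) (n : nat) : set 'rV[R]_n :=
  [set x | enorm x <= 1].

Definition euclidean_sphere (R : realType) (n : nat) : set 'rV[R]_n :=
  [set x | enorm x = 1].

Arguments euclidean_ball R n : clear implicits.
Arguments euclidean_sphere R n : clear implicits.

Definition grassmannian (R : realType) (n m : nat) : Type :=
  {H : {vspace 'rV[R]_n} | \dim H == m}.

Definition gset (R : realType) (n m : nat) (H : grassmannian R n m) :
    set 'rV[R]_n :=
  [set x | x \in val H].

(* The rows of the matrix form an orthonormal basis of H. *)
Definition orthonormal_basis (R : realType) (n m : nat) (H : grassmannian R n m) :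
    set 'M[R]_(m, n) :=
  [set B | B *m B^T = 1%:M /\ forall i, row i B \in val H].

(* m-dimensional Lebesgue measure of H (induced Euclidean structure), seen as a
   measure on R^n carried by H: the image of Lebesgue measure on R^m under the
   isometry y |-> y *m B given by an orthonormal basis B of H.  It does not
   depend on B, because Lebesgue measure is orthogonally invariant. *)
Definition lebesgue_sub (R : realType) (n m : nat) (H : grassmannian R n m) :
    set (borel_rV R n) -> \bar R :=
  pushforward (lebesgue_rV R m)
    (fun y : borel_rV R m =>
       ((y : 'rV[R]_m) *m xget 0 (orthonormal_basis H) : borel_rV R n)).

(* The unnormalized surface measure on the Euclidean unit sphere of an
   m-dimensional space with Lebesgue measure mu, by the cone formula
   sigma(A) = m mu({t u : u in A, 0 < t <= 1}).  For m = 1 it is the counting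
   measure on the two unit vectors. *)
Definition surface_measure (R : realType) (n m : nat)
    (mu : set (borel_rV R n) -> \bar R) : set (borel_rV R n) -> \bar R :=
  fun A => (m%:R%:E *
    mu [set t *: u | t in `]0%R, 1%R] & u in A `&` euclidean_sphere R n])%E.

Definition sphere_integral (R : realType) (n : nat) (f : 'rV[R]_n -> R) : R :=
  fine (\int[surface_measure n (lebesgue_rV R n)]_(x in
    (euclidean_sphere R n : set (borel_rV R n))) (f x)%:E).

(* Elements of C(S^(n-1)) are represented by functions on R^n whose restriction
   to the sphere is continuous; their values off the sphere are never used. *)
Definition sphere_continuous (R : realType) (n : nat) : set ('rV[R]_n -> R) :=
  [set f | {within euclidean_sphere R n, continuous f}].
Arguments sphere_continuous R n : clear implicits.

Definition radon (R : realType) (n m : nat) (f : 'rV[R]_n -> R) :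
    grassmannian R n m -> R :=
  fun H => fine (\int[surface_measure m (lebesgue_sub H)]_(x in
    (euclidean_sphere R n `&` gset H : set (borel_rV R n))) (f x)%:E).

Definition radon_range (R : realType) (n m : nat) :
    set (grassmannian R n m -> R) :=
  [set radon f | f in sphere_continuous R n].

(* M^+(X) for X = radon_range: nu is a function on all of grassmannian -> R,
   but only its restriction to X is constrained or used.  The sup norm topology
   on X is the one induced by uniform convergence. *)
Definition radon_dual_pos (R : realType) (n m : nat)
    (nu : (grassmannian R n m -> R) -> R) : Prop :=
  [/\ (forall (a : R) g h, radon_range g -> radon_range h ->
         nu (fun H => a * g H + h H) = a * nu g + nu h),
      {within (@radon_range R n m : set {uniform grassmannian R n m -> R}),
         continuous (nu : {uniform grassmannian R n m -> R} -> R)} &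
      forall g, radon_range g -> (forall H, 0 <= g H) -> 0 <= nu g].

(* For K closed, bounded and with 0 in its interior the infimum is a minimum. *)
Definition minkowski_functional (R : realType) (n : nat)
    (K : set 'rV[R]_n) (x : 'rV[R]_n) : R :=
  inf [set a : R | 0 <= a /\ [set a *: y | y in K] x].

Definition boundary (T : topologicalType) (K : set T) : set T :=
  closure K `\` K°.

Definition star_body (R : realType) (n : nat) (K : set 'rV[R]_n) : Prop :=
  [/\ closed K,
      bounded_set K,
      (forall u : 'rV[R]_n, u != 0 ->
         exists p q : 'rV[R]_n, p <> q /\
           boundary K `&` [set t *: u | t in [set: R]] `&` ~` [set 0] =
           [set p; q]),
      K° 0 &
      continuous (minkowski_functional K)].

Definition origin_symmetric (R : realType) (n : nat) (K : set 'rV[R]_n) : Prop :=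
  [set - x | x in K] = K.

Definition generalized_intersection_body (R : realType) (n k : nat)
    (K : set 'rV[R]_n) : Prop :=
  exists2 nu : (grassmannian R n (n - k)%N -> R) -> R, radon_dual_pos nu &
    forall f, sphere_continuous R n f ->
      sphere_integral (fun x => minkowski_functional K x ^- k * f x) = nu (radon f).

Definition vol (R : realType) (n : nat) (K : set 'rV[R]_n) : R :=
  fine (lebesgue_rV R n K).

Definition vol_sub (R : realType) (n m : nat) (H : grassmannian R n m)
    (K : set 'rV[R]_n) : R :=
  fine (lebesgue_sub H K).

(* Main.v *)
From HB Require Import structures.
Require Import Defs.
From mathcomp Require Import all_boot all_order all_algebra.
From mathcomp Require Import all_classical all_reals all_analysis.
From mathcomp Require Import measurable_realfun.
From mathcomp Require Import ring lra.

(** Write m = n - k, let s be the largest gap between the volumes of the sections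
    of K and L by m-dimensional subspaces, and let rho_K, rho_L be the radial
    functions, rho_K(x) = 1 / ||x||_K on the unit sphere.  Exchanging K and L, it is
    enough to bound Vol(K)^(m/n) - Vol(L)^(m/n) from above.

    In polar coordinates, m Vol(K cap H) is the integral of rho_K^m over the unit
    sphere of H, that is, its Radon transform at H.  Hence the function
    f = c + rho_L^m - rho_K^m with c = s / |B_2^m| has Radon transform
    m (s + Vol(L cap H) - Vol(K cap H)) >= 0.  As K is a generalized k-intersection
    body, the positive functional nu of K gives
    0 <= nu(R f) = int rho_K^k f over the unit sphere, that is,
    int rho_K^n <= int rho_K^k rho_L^m + c int rho_K^k 1^m.
    The left side is n Vol(K).  By Hoelder's inequality with exponents n/k and n/m,
    the right side is at most
    n Vol(K)^(k/n) (Vol(L)^(m/n) + c |B_2^n|^(m/n)),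
    and division by n Vol(K)^(k/n) gives the theorem ([le_of_section_gaps]).

    The surface measure on the sphere of an m-dimensional subspace is defined by
    cones, so it is m times the image of Lebesgue measure on the punctured unit ball
    of R^m under an isometric embedding followed by normalization
    ([surface_measure_integral]).  All integrals are therefore written over the
    punctured ball of R^m or R^n, and neither spheres nor subspaces appear in the
    estimates.  Polar coordinates then amount to the formula
    Vol(K) = int rho_K^n over the ball, which follows from the scaling law of
    Lebesgue measure ([polar_volume]).  The measure of a subspace is the image of
    that of R^m by one orthonormal basis, which exists by [orthonormal_rows].
    Finally, a star body must be the set where its Minkowski functional is at most 1;
    this is where the condition on the boundary points of lines enters
    ([star_shaped], [minkowski_le1]). *)

Set Implicit Arguments.
Unset Strict Implicit.
Unset Printing Implicit Defensive.

Import Order.TTheory GRing.Theory Num.Theory.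
Import numFieldNormedType.Exports.
Local Open Scope classical_set_scope.
Local Open Scope ring_scope.

(** * The Borel sigma-algebra of R^n *)

Lemma borel_rV_open (R : realType) (n : nat) (U : set 'rV[R]_n) :
  open U -> measurable (U : set (borel_rV R n)).
Proof. by move=> oU; apply: sub_sigma_algebra. Qed.

Lemma continuous_borel_rV (R : realType) (n : nat) (f : 'rV[R]_n -> R) :
  continuous f -> measurable_fun [set: borel_rV R n] f.
Proof.
move=> /continuousP cf; apply: (measurability _ (RGenOpens.measurableE R)).
move=> _ [_ [a [b ->]] <-]; rewrite setTI.
by apply: borel_rV_open; apply: cf; exact: interval_open.
Qed.

Lemma measurable_coord (R : realType) (n : nat) (i : 'I_n) :
  measurable_fun [set: borel_rV R n] (fun x : borel_rV R n => (x : 'rV[R]_n) 0 i).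
Proof. apply: continuous_borel_rV; exact: coord_continuous. Qed.

(** The balls are taken for the sup norm of the topology on R^n, so that they are
    cubes; their centers are rational and their radii are inverses of integers,
    hence the family is countable. *)
Lemma open_rat_ball (R : realType) (n : nat) (U : set 'rV[R]_n) : open U ->
  U = \bigcup_(cr in [set cr : 'rV[rat]_n * nat |
        ball (map_mx ratr cr.1 : 'rV[R]_n) cr.2.+1%:R^-1 `<=` U])
      ball (map_mx ratr cr.1 : 'rV[R]_n) cr.2.+1%:R^-1.
Proof.
move=> oU; apply/seteqP; split=> [x Ux|x [cr crU]]; last exact: crU.
have /nbhs_ballP [e /= e0 eU] := open_nbhs_nbhs (conj oU Ux).
have [k ke] : exists k, (k.+1%:R : R)^-1 < e / 2.
  have [k _ /(_ k (leqnn _))] := near_infty_natSinv_lt (PosNum (divr_gt0 e0 (ltr0n _ 2))).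
  by exists k.
have k0 : 0 < (k.+1%:R : R)^-1 by rewrite invr_gt0.
pose P i (q : rat) := `|x 0 i - ratr q| < (k.+1%:R : R)^-1.
have /choice [q qP] : forall i, exists q : rat, P i q.
  move=> i.
  have /rat_in_itvoo [q] : x 0 i - k.+1%:R^-1 < x 0 i + k.+1%:R^-1 by rewrite ltrD2l gtrN.
  by rewrite in_itv/= => qx; exists q; rewrite /P distrC ltr_distl.
(* The center is within 1/(k+1) < e/2 of x, so the ball lies within e of x. *)
have bx : ball (map_mx ratr (\row_i q i) : 'rV[R]_n) k.+1%:R^-1 x.
  split=> // i j; rewrite ord1 !mxE /ball /= distrC; exact: qP.
exists (\row_i q i, k) => //= y yc; apply: eU.
have half u : ball (map_mx ratr (\row_i q i) : 'rV[R]_n) k.+1%:R^-1 u ->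
    ball (map_mx ratr (\row_i q i) : 'rV[R]_n) (e / 2) u.
  by apply: le_ball; exact: ltW.
exact: ball_splitr (half _ bx) (half _ yc).
Qed.

(** The sigma-algebra of R^n is generated by open sets, but maps into R^n are
    only accessible through their coordinates.  The bridge is second
    countability: an open set is a countable union of cubes, and the preimage of
    a cube is a finite intersection of preimages under the coordinates. *)
Lemma measurable_fun_rV d (T : measurableType d) (R : realType) (n : nat)
    (f : T -> borel_rV R n) :
  (forall i, measurable_fun setT (fun t => (f t : 'rV[R]_n) 0 i)) ->
  measurable_fun setT f.
Proof.
move=> mf; apply: (@measurability _ _ T (borel_rV R n) setT f (@open 'rV[R]_n)) => //.
move=> _ [U oU <-]; rewrite setTI (open_rat_ball oU) preimage_bigcup.
rewrite bigcup_mkcond; apply: countable_bigcupT_measurable => // -[c k].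
case: ifPn => _; last exact: measurable0.
rewrite /= (_ : _ @^-1` _ = \bigcap_(i in [set: 'I_n])
   ((fun t => (f t : 'rV[R]_n) 0 i) @^-1` ball (ratr (c 0 i) : R) k.+1%:R^-1)).
  apply: fin_bigcap_measurable => // i _; rewrite -[X in measurable X]setTI.
  by apply: mf => //; exact: measurable_ball.
apply/seteqP; split=> [t /= [_ h] i _|t h]; first by have := h 0 i; rewrite mxE.
by split=> [|i j]; [rewrite invr_gt0|rewrite ord1 mxE; exact: h].
Qed.

(** The map along which [lebesgue_rV] transports the product measure. *)
Definition row_cons (R : realType) (n : nat)
    (p : measurableTypeR R * borel_rV R n) : borel_rV R n.+1 :=
  (row_mx (p.1 : R)%:M (p.2 : 'rV[R]_n) : borel_rV R n.+1).

Lemma measurable_row_cons (R : realType) (n : nat) :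
  measurable_fun setT (@row_cons R n).
Proof.
apply: measurable_fun_rV => i.
case: (@split_ordP 1 n i) => j ->; rewrite /row_cons.
  rewrite [X in measurable_fun _ X](_ : _ = fst); first exact: measurable_fst.
  by apply/funext => p; rewrite /= (@row_mxEl _ 1 1 n) ord1 mxE eqxx.
rewrite [X in measurable_fun _ X](_ : _ =
   (fun x : borel_rV R n => (x : 'rV[R]_n) 0 j) \o snd).
  by apply: measurableT_comp; [exact: measurable_coord|exact: measurable_snd].
by apply/funext => p; rewrite /= (@row_mxEr _ 1 1 n).
Qed.

(** * Lebesgue measure on R^n: sigma-finiteness, cubes, scaling *)

(** Equality as set functions, and not only on measurable sets, is what allows a
    set function given by a formula to be replaced by a bundled measure. *)
Lemma measure_pushforward_sigma_finite d d' (T1 : measurableType d)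
    (T2 : measurableType d') (R : realType)
    (mu : {measure set T1 -> \bar R}) (f : T1 -> T2) :
  measurable_fun setT f -> sigma_finite setT (pushforward mu f) ->
  exists nu : {sigma_finite_measure set T2 -> \bar R},
    (nu : set T2 -> \bar R) = pushforward mu f.
Proof.
move=> mf sf.
pose M : {measure set T2 -> \bar R} :=
  measure_function_pushforward__canonical__measure_function_Measure mu mf.
pose S := Measure_isSigmaFinite.Build _ _ _ (M : set T2 -> \bar R) sf.
pose N : {sigma_finite_measure set T2 -> \bar R} :=
  HB.pack (pushforward mu f) S.
by exists (N mf).
Qed.

Lemma coord_le_mx_norm (R : realType) (n : nat) (x : 'rV[R]_n) (i : 'I_n) :
  `|x 0 i| <= `|x|.
Proof.
rewrite [leRHS]/Num.norm /= mx_normrE.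
by apply/bigmax_geP; right => /=; exists (0, i).
Qed.

Definition cube (R : realType) (n : nat) (r : R) : set 'rV[R]_n :=
  [set x | forall i, `|x 0 i| <= r].

Lemma measurable_cube (R : realType) (n : nat) (r : R) :
  measurable (@cube R n r : set (borel_rV R n)).
Proof.
rewrite (_ : cube r = \bigcap_(i in [set: 'I_n])
    ((fun x : borel_rV R n => (x : 'rV[R]_n) 0 i) @^-1` `[- r, r]%classic)).
  apply: fin_bigcap_measurable => // i _; rewrite -[X in measurable X]setTI.
  by apply: measurable_coord => //; exact: measurable_itv.
apply/seteqP; split=> [x h i _|x h i].
  by rewrite /= in_itv /= -ler_norml; exact: h.
by have := h i I; rewrite /= in_itv /= -ler_norml.
Qed.

Lemma row_cons_cube (R : realType) (n : nat) (r : R) :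
  @row_cons R n @^-1` cube r = `[- r, r]%classic `*` cube r.
Proof.
apply/seteqP; split=> [[a v] h|[a v] [/= ha h] i].
  split=> [|i] /=.
    rewrite in_itv /= -ler_norml; have := h (@lshift 1 n ord0).
    by rewrite /row_cons (@row_mxEl _ 1 1 n) mxE eqxx.
  by have := h (@rshift 1 n i); rewrite /row_cons (@row_mxEr _ 1 1 n).
rewrite in_itv /= -ler_norml in ha.
case: (@split_ordP 1 n i) => j ->; rewrite /row_cons.
  by rewrite (@row_mxEl _ 1 1 n) ord1 mxE eqxx.
by rewrite (@row_mxEr _ 1 1 n); exact: h.
Qed.

(** Sigma-finiteness of the n-dimensional measure is what makes the next product
    a measure, and it comes from the finite volume of cubes; hence the two facts
    are proved by one induction. *)
Lemma lebesgue_rV_sigma_finite_cube (R : realType) (n : nat) :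
  exists2 mu : {sigma_finite_measure set (borel_rV R n) -> \bar R},
    (mu : set (borel_rV R n) -> \bar R) = lebesgue_rV R n &
    forall r : R, 0 <= r -> mu (cube r) = ((2 * r) ^+ n)%:E.
Proof.
elim: n => [|n [mu IH IHc]].
  exists (@dirac _ (borel_rV R 0) 0 R) => // r r0.
  by rewrite expr0 /= diracE mem_set // => -[].
pose P : {measure set (measurableTypeR R * borel_rV R n)%type -> \bar R} :=
  (@lebesgue_measure R \x mu)%E.
have Pc (r : R) : 0 <= r ->
    pushforward P (@row_cons R n) (cube r) = ((2 * r) ^+ n.+1)%:E.
  move=> r0; rewrite /pushforward row_cons_cube /P /= product_measure1E //.
  - rewrite IHc// exprS EFinM; congr (_ * _)%E.
    rewrite [LHS]lebesgue_measure_itv/= lte_fin.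
    move: r0; rewrite le_eqVlt => /predU1P[<-|r0]; first by rewrite oppr0 ltxx mulr0.
    by rewrite gtrN// -EFinB opprK mulr_natl mulr2n.
  - exact: measurable_cube.
have [|nu nuE] := measure_pushforward_sigma_finite (mu := P) (@measurable_row_cons R n).
  exists (fun k => cube k%:R) => [|k]; last first.
    by split; [exact: measurable_cube|rewrite Pc// ltry].
  apply/seteqP; split=> // x _.
  exists (Num.bound `|x|) => // i.
  by rewrite (le_trans (coord_le_mx_norm x i))// ltW// archi_boundP.
exists nu; first by rewrite nuE /= -IH.
by move=> r r0; rewrite nuE Pc.
Qed.

(** The measure t * lambda(t^-1 A) agrees with lambda on intervals. *)
Lemma lebesgue_measure_scale (R : realType) (t : R) (A : set (measurableTypeR R)) :
  0 < t -> measurable A ->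
  lebesgue_measure ([set x | A (t * x)] : set (measurableTypeR R)) =
  (t^-1%:E * lebesgue_measure A)%E.
Proof.
move=> t0 mA.
have mt : measurable_fun setT (fun x : measurableTypeR R => t * x : measurableTypeR R).
  exact: (@measurable_funM _ (measurableTypeR R) R setT (cst t) id).
pose P : {measure set (measurableTypeR R) -> \bar R} :=
  measure_function_pushforward__canonical__measure_function_Measure (@lebesgue_measure R) mt.
pose c : {nonneg R} := NngNum (ltW t0).
have /= E := @lebesgue_measure_unique R (mscale c P).
rewrite (E _ A mA).
  by rewrite /mscale /= muleA -EFinM mulVf ?gt_eqF// mul1e.
move=> _ [[a b] _ <-].
rewrite /mscale /= /P /= /pushforward.
rewrite (_ : _ @^-1` _ = `]a / t, b / t]%classic).
  rewrite !lebesgue_measure_itv/= !lte_fin ltr_pM2r ?invr_gt0//.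
  case: ifP => _; last by rewrite mule0.
  by rewrite -!EFinB -EFinM; congr EFin; rewrite -mulrBl mulrC mulfVK// gt_eqF.
by apply/seteqP; split=> x /=; rewrite !in_itv/= ltr_pdivrMr// ler_pdivlMr// mulrC.
Qed.

Lemma measurable_fun_scale (R : realType) (n : nat) (t : R) :
  measurable_fun setT (fun x : borel_rV R n => (t *: (x : 'rV[R]_n) : borel_rV R n)).
Proof.
apply: measurable_fun_rV => i.
rewrite [X in measurable_fun _ X](_ : _ = fun x : borel_rV R n => t * (x : 'rV[R]_n) 0 i).
  by apply: measurable_funM => //; exact: measurable_coord.
by apply/funext => x; rewrite mxE.
Qed.

Lemma row_consZ (R : realType) (n : nat) (t : R) p :
  (t *: (@row_cons R n p : 'rV[R]_n.+1) : borel_rV R n.+1) =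
  row_cons (t * p.1, (t *: (p.2 : 'rV[R]_n) : borel_rV R n)).
Proof. by rewrite /row_cons /= -scale_scalar_mx; exact: (@scale_row_mx R 1 1 n). Qed.

(** Same uniqueness argument as on the line, now on rectangles, where scaling acts
    on the two factors separately. *)
Lemma lebesgue_rV_scale (R : realType) (n : nat) (t : R) (A : set (borel_rV R n)) :
  0 < t -> measurable A ->
  lebesgue_rV R n [set x | A (t *: (x : 'rV[R]_n))] = ((t ^- n)%:E * lebesgue_rV R n A)%E.
Proof.
move=> t0; elim: n A => [A mA|n IH A mA].
  rewrite expr0 invr1 mul1e; congr (dirac _ _).
  by apply/seteqP; split=> x /=; rewrite [t *: x]thinmx0 [x]thinmx0.
have [mu muE _] := lebesgue_rV_sigma_finite_cube R n.
rewrite -muE in IH; rewrite /= -muE /pushforward.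
set lam := (@lebesgue_measure R).
have mA' : measurable (@row_cons R n @^-1` A).
  by rewrite -[X in measurable X]setTI; exact: measurable_row_cons.
pose s (p : measurableTypeR R * borel_rV R n) : measurableTypeR R * borel_rV R n :=
  (t * p.1, (t *: (p.2 : 'rV[R]_n) : borel_rV R n)).
have ms : measurable_fun setT s.
  apply: measurable_fun_pair.
    apply: (@measurable_funM _ _ R setT (cst t) fst) => //; exact: measurable_fst.
  by apply: (measurableT_comp (@measurable_fun_scale R n t)); exact: measurable_snd.
pose P : {measure set (measurableTypeR R * borel_rV R n)%type -> \bar R} :=
  measure_function_pushforward__canonical__measure_function_Measure (lam \x mu)%E ms.
have tn0 : 0 < t ^+ n.+1 by rewrite exprn_gt0.
pose c : {nonneg R} := NngNum (ltW tn0).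
have E := @product_measure_unique _ _ _ _ R lam mu (mscale c P).
transitivity (P (@row_cons R n @^-1` A)).
  rewrite /P /= /pushforward; congr ((_ \x _)%E _).
  by apply/seteqP; split=> p /=; rewrite row_consZ.
rewrite [X in (_ * X)%E](E _ _ mA').
  by rewrite /mscale /= muleA -EFinM mulVf ?gt_eqF// mul1e.
move=> B C mB mC.
have mBt : measurable ([set x | B (t * x)] : set (measurableTypeR R)).
  rewrite -[X in measurable X]setTI.
  exact: (@measurable_funM _ (measurableTypeR R) R setT (cst t) id).
have mCt : measurable ([set x | C (t *: (x : 'rV[R]_n))] : set (borel_rV R n)).
  by rewrite -[X in measurable X]setTI; exact: measurable_fun_scale.
have PE : (lam \x mu)%E ([set x | B (t * x)] `*` [set x | C (t *: (x : 'rV[R]_n))]) =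
  (t^-1%:E * lam B * ((t ^- n)%:E * mu C))%E.
  by rewrite product_measure1E // IH //; congr (_ * _)%E; exact: lebesgue_measure_scale.
transitivity ((t ^+ n.+1)%:E * (t^-1%:E * lam B * ((t ^- n)%:E * mu C)))%E.
  by rewrite -PE.
have tE : (t^-1%:E * (t ^- n)%:E)%E = ((t ^+ n.+1)^-1)%:E.
  by rewrite -EFinM -invfM -exprS.
rewrite muleACA tE (muleA (t ^+ n.+1)%:E) -EFinM mulfV ?gt_eqF//.
by rewrite mul1e.
Qed.

(** * The Euclidean norm *)

Lemma enorm_ge0 (R : realType) (n : nat) (x : 'rV[R]_n) : 0 <= enorm x.
Proof. exact: sqrtr_ge0. Qed.

Lemma sqr_enorm (R : realType) (n : nat) (x : 'rV[R]_n) :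
  enorm x ^+ 2 = \sum_(i < n) x 0 i ^+ 2.
Proof. by rewrite sqr_sqrtr// sumr_ge0// => i _; rewrite sqr_ge0. Qed.

Lemma enormZ (R : realType) (n : nat) (t : R) (x : 'rV[R]_n) :
  enorm (t *: x) = `|t| * enorm x.
Proof.
rewrite /enorm -sqrtr_sqr -sqrtrM ?sqr_ge0// mulr_sumr; congr Num.sqrt.
by apply: eq_bigr => i _; rewrite mxE exprMn.
Qed.

Lemma enorm0 (R : realType) (n : nat) : enorm (0 : 'rV[R]_n) = 0.
Proof. by rewrite -(scale0r 0) enormZ normr0 mul0r. Qed.

Lemma enorm_mulmx (R : realType) (m n : nat) (B : 'M[R]_(m, n)) (y : 'rV[R]_m) :
  B *m B^T = 1%:M -> enorm (y *m B) = enorm y.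
Proof.
move=> BB; suff sumE k (z : 'rV[R]_k) : \sum_(i < k) z 0 i ^+ 2 = (z *m z^T) 0 0.
  by rewrite /enorm !sumE trmx_mul mulmxA -(mulmxA y) BB mulmx1.
by rewrite mxE; apply: eq_bigr => i _; rewrite mxE expr2.
Qed.

Lemma mx_norm_le_enorm (R : realType) (n : nat) (x : 'rV[R]_n) : `|x| <= enorm x.
Proof.
rewrite [leLHS]/Num.norm /= mx_normrE; apply/bigmax_leP; split; first exact: enorm_ge0.
move=> [i j] _ /=; rewrite ord1 -sqrtr_sqr ler_sqrt ?sumr_ge0//; last first.
  by move=> k _; exact: sqr_ge0.
by rewrite (bigD1 j)//= lerDl sumr_ge0// => k _; exact: sqr_ge0.
Qed.

Lemma enorm_le_mx_norm (R : realType) (n : nat) (x : 'rV[R]_n) :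
  enorm x <= n%:R * `|x|.
Proof.
rewrite -(@ler_pXn2r _ 2)// ?nnegrE ?enorm_ge0 ?mulr_ge0// sqr_enorm.
apply: (@le_trans _ _ (\sum_(i < n) `|x| ^+ 2)).
  apply: ler_sum => i _; rewrite -(@real_normK _ (x 0 i)) ?num_real//.
  by rewrite ler_pXn2r ?nnegrE// coord_le_mx_norm.
rewrite sumr_const card_ord exprMn -[leLHS]mulr_natl ler_wpM2r ?sqr_ge0// -natrX ler_nat.
by case: n {x} => // n; rewrite leq_pmulr.
Qed.

Lemma enorm_gt0 (R : realType) (n : nat) (x : 'rV[R]_n) : (0 < enorm x) = (x != 0).
Proof.
apply/idP/idP => [|x0]; first by apply: contraTneq => ->; rewrite enorm0 ltxx.
by apply: lt_le_trans (mx_norm_le_enorm x); rewrite normr_gt0.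
Qed.

Lemma continuous_enorm (R : realType) (n : nat) : continuous (@enorm R n).
Proof.
move=> x; apply: (continuous_comp (f := fun x : 'rV[R]_n => \sum_(i < n) x 0 i ^+ 2)).
  apply: (@cvg_big _ _ +%R 0 _ _ _ (nbhs x) _ _ _ (nbhs_filter x)) => [|i _].
    exact: add_continuous.
  have := @continuous_comp _ _ _ (fun y : 'rV[R]_n => y 0 i) (fun a : R => a ^+ 2) x.
  by apply; [exact: coord_continuous|exact: exprn_continuous].
exact: sqrt_continuous.
Qed.

Lemma measurable_enorm (R : realType) (n : nat) :
  measurable_fun [set: borel_rV R n] (@enorm R n).
Proof. by apply: continuous_borel_rV; exact: continuous_enorm. Qed.

(** For nonnegative arguments the inverse is a real power. *)
Lemma measurable_funV_ge0 d (T : measurableType d) (R : realType) (f : T -> R) :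
  (forall x, 0 <= f x) -> measurable_fun setT f ->
  measurable_fun setT (fun x => (f x)^-1).
Proof.
move=> f0 mf; under eq_fun do rewrite -powR_inv1//.
exact: (measurableT_comp (measurable_powR _)).
Qed.

Lemma measurable_linear_rV (R : realType) (m n : nat)
    (f : {linear 'rV[R]_m -> 'rV[R]_n}) :
  measurable_fun setT (f : borel_rV R m -> borel_rV R n).
Proof.
apply: measurable_fun_rV => i.
rewrite [X in measurable_fun _ X](_ : _ = fun x : borel_rV R m =>
   \sum_(j < m) (x : 'rV[R]_m) 0 j * f (delta_mx 0 j) 0 i).
  by apply: measurable_sum => j; apply: measurable_funM => //; exact: measurable_coord.
apply/funext => x; rewrite {1}[x]row_sum_delta linear_sum summxE.
by apply: eq_bigr => j _; rewrite linearZ mxE.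
Qed.

(** A subspace is the set of fixed points of a linear projection onto it, and a
    linear map is measurable because its coordinates are. *)
Lemma measurable_gset (R : realType) (n m : nat) (H : grassmannian R n m) :
  measurable (gset H : set (borel_rV R n)).
Proof.
rewrite (_ : gset H = \bigcap_(i in [set: 'I_n])
   ((fun x : borel_rV R n => (projv (val H) x - x) 0 i) @^-1` [set 0])).
  apply: fin_bigcap_measurable => // i _; rewrite -[X in measurable X]setTI.
  suff mf : measurable_fun setT
    (fun x : borel_rV R n => (projv (val H) x - x) 0 i) by apply: mf.
  rewrite [X in measurable_fun _ X](_ : _ =
    (fun x : borel_rV R n => (projv (val H) x : 'rV[R]_n) 0 i - (x : 'rV[R]_n) 0 i)).
    apply: measurable_funB; last exact: measurable_coord.
    apply: (measurableT_comp (@measurable_coord R n i)).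
    exact: (@measurable_linear_rV R n n (projv (val H))).
  by apply/funext => x; rewrite !mxE.
apply/seteqP; split=> [x /= xH i _|x h /=].
  by rewrite /= projv_id// subrr mxE.
rewrite (_ : x = projv (val H) x); first exact: memv_proj.
apply/eqP; rewrite eq_sym -subr_eq0; apply/eqP/rowP => i.
by rewrite (h i I) mxE.
Qed.

(** * Surface measures as images of Lebesgue measure *)

(** Every integral below is taken over this set.  The origin is left out because
    it has no direction. *)
Definition punctured_ball (R : realType) (n : nat) : set 'rV[R]_n :=
  [set y | 0 < enorm y <= 1].

Lemma measurable_punctured_ball (R : realType) (n : nat) :
  measurable (@punctured_ball R n : set (borel_rV R n)).
Proof.
rewrite (_ : @punctured_ball R n = (@enorm R n @^-1` `]0, 1]%classic)).
  by rewrite -[X in measurable X]setTI; apply: measurable_enorm => //; exact: measurable_itv.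
by apply/seteqP; split=> x /=; rewrite in_itv.
Qed.

(** For B with orthonormal rows, y |-> y *m B is an isometry from R^m onto a
    subspace, and this is the radial projection of the image of y to the sphere. *)
Definition direction (R : realType) (m n : nat) (B : 'M[R]_(m, n)) (y : 'rV[R]_m) :
  'rV[R]_n := (enorm y)^-1 *: (y *m B).

Lemma measurable_mulmxr (R : realType) (m n : nat) (B : 'M[R]_(m, n)) :
  measurable_fun setT (fun y : borel_rV R m => ((y : 'rV[R]_m) *m B : borel_rV R n)).
Proof. exact: (@measurable_linear_rV R m n (mulmxr B)). Qed.

(** Extended by 0 outside the punctured ball: 0 is not on the sphere, so preimages
    of parts of the sphere see the punctured ball only. *)
Definition ball_direction (R : realType) (m n : nat) (B : 'M[R]_(m, n))
    (y : borel_rV R m) : borel_rV R n :=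
  \1_(@punctured_ball R m) y *: direction B y.

Lemma measurable_ball_direction (R : realType) (m n : nat) (B : 'M[R]_(m, n)) :
  measurable_fun setT (ball_direction B).
Proof.
apply: measurable_fun_rV => i.
rewrite [X in measurable_fun _ X](_ : _ = fun y : borel_rV R m =>
  \1_(@punctured_ball R m) y * ((enorm y)^-1 * ((y : 'rV[R]_m) *m B) 0 i)); last first.
  by apply/funext => y; rewrite /ball_direction /direction !mxE.
apply: measurable_funM; first by apply: measurable_indic; exact: measurable_punctured_ball.
apply: measurable_funM.
  apply: (@measurable_funV_ge0 _ (borel_rV R m)) => [y|]; first exact: enorm_ge0.
  exact: measurable_enorm.
by apply: (measurableT_comp (@measurable_coord R n i)); exact: measurable_mulmxr.
Qed.

Lemma enorm_direction (R : realType) (m n : nat) (B : 'M[R]_(m, n)) (y : 'rV[R]_m) :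
  B *m B^T = 1%:M -> 0 < enorm y -> enorm (direction B y) = 1.
Proof.
move=> BB y0; rewrite /direction enormZ enorm_mulmx// ger0_norm ?invr_ge0 ?enorm_ge0//.
by rewrite mulVf// gt_eqF.
Qed.

(** A unit vector u is the direction of t u for all t > 0; so the cone over A that
    defines the surface measure consists of the points of the punctured ball whose
    direction lies in A. *)
Lemma preimage_cone (R : realType) (m n : nat) (B : 'M[R]_(m, n)) (A : set 'rV[R]_n) :
  B *m B^T = 1%:M ->
  [set y : 'rV[R]_m | [set t *: u | t in `]0%R, 1%R] &
                        u in A `&` euclidean_sphere R n] (y *m B)] =
  ball_direction B @^-1` (A `&` euclidean_sphere R n).
Proof.
move=> BB; apply/seteqP; split=> y /=.
  move=> [t]; rewrite /= in_itv /= => /andP[t0 t1] [u [Au Su] tuE].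
  have ty : enorm y = t.
    by rewrite -(enorm_mulmx y BB) -tuE enormZ Su mulr1 gtr0_norm.
  rewrite /ball_direction /direction indicE mem_set; last by rewrite /punctured_ball /= ty t0.
  by rewrite scale1r ty -tuE scalerA mulVf ?gt_eqF// scale1r.
rewrite /ball_direction indicE => -[].
case: (boolP (y \in _)) => [/set_mem /= /andP[y0 y1]|_]; last first.
  by rewrite scale0r /euclidean_sphere /= enorm0 => _ /esym/eqP; rewrite oner_eq0.
rewrite scale1r => Ay y'1; exists (enorm y); first by rewrite /= in_itv /= y0.
exists (direction B y) => //.
by rewrite /direction scalerA mulfV ?gt_eqF// scale1r.
Qed.

Lemma ball_direction_sphere (R : realType) (m n : nat) (B : 'M[R]_(m, n)) (T : set 'rV[R]_n) :
  B *m B^T = 1%:M -> (forall y : 'rV[R]_m, T (y *m B)) -> (forall t x, T x -> T (t *: x)) ->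
  ball_direction B @^-1` (euclidean_sphere R n `&` T) = @punctured_ball R m.
Proof.
move=> BB TB TZ; apply/seteqP; split=> y /=; rewrite /ball_direction indicE.
  case: (boolP (y \in _)) => [/set_mem //|_].
  by rewrite scale0r /euclidean_sphere /= enorm0 => -[/esym/eqP]; rewrite oner_eq0.
move=> Dy; rewrite mem_set// scale1r; split; last exact: TZ.
by apply: enorm_direction => //; case/andP: Dy.
Qed.

Lemma measurable_euclidean_sphere (R : realType) (n : nat) :
  measurable (euclidean_sphere R n : set (borel_rV R n)).
Proof.
rewrite (_ : euclidean_sphere R n = (@enorm R n @^-1` [set 1])) //.
by rewrite -[X in measurable X]setTI; apply: measurable_enorm.
Qed.

(** By [preimage_cone] the surface measure is m times the image of Lebesgue measure
    on the punctured ball under the direction map, whence a change of variables.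
    The cases of interest are B = 1, where the set T is everything (integrals over
    the whole sphere), and B an orthonormal basis of T (the Radon transform). *)
Lemma surface_measure_integral (R : realType) (m n : nat) (B : 'M[R]_(m, n))
    (mu : {measure set (borel_rV R m) -> \bar R}) (T : set 'rV[R]_n)
    (f : 'rV[R]_n -> R) :
  B *m B^T = 1%:M -> (forall y : 'rV[R]_m, T (y *m B)) -> (forall t x, T x -> T (t *: x)) ->
  measurable (T : set (borel_rV R n)) ->
  measurable_fun [set: borel_rV R n] f ->
  mu.-integrable (@punctured_ball R m : set (borel_rV R m))
    (EFin \o (fun y => f (direction B y))) ->
  (\int[surface_measure m (pushforward mu
      (fun y : borel_rV R m => ((y : 'rV[R]_m) *m B : borel_rV R n)))]_(x in
      (euclidean_sphere R n `&` T : set (borel_rV R n))) (f x)%:E)%E =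
  (m%:R%:E * \int[mu]_(y in (@punctured_ball R m : set (borel_rV R m)))
     (f (direction B y))%:E)%E.
Proof.
move=> BB TB TZ mT mf intf.
pose P : {measure set (borel_rV R n) -> \bar R} :=
  measure_function_pushforward__canonical__measure_function_Measure mu
    (measurable_ball_direction B).
have mm : 0 <= m%:R :> R by [].
pose c : {nonneg R} := NngNum mm.
have mST : measurable (euclidean_sphere R n `&` T : set (borel_rV R n)).
  by apply: measurableI => //; exact: measurable_euclidean_sphere.
have mS := @measurable_euclidean_sphere R n.
have -> : surface_measure m (pushforward mu
      (fun y : borel_rV R m => ((y : 'rV[R]_m) *m B : borel_rV R n))) =
    mscale c (mrestr P mS).
  apply/funext => A; rewrite /surface_measure /mscale /=; congr (_ * _)%E.
  by rewrite /pushforward /mrestr /P /= /pushforward -(preimage_cone _ BB).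
rewrite (eq_measure_integral (mscale c P)); last first.
  move=> A mA AST; rewrite /mscale; congr (_ * _)%E.
  by rewrite /= /mrestr (_ : A `&` _ = A)//; apply: setIidl => x /AST[].
have mDe := @measurable_punctured_ball R m.
have mfE : measurable_fun [set: borel_rV R n] (EFin \o f) by exact/measurable_EFinP.
(* The variable is changed for nonnegative functions, hence for the positive and
   negative parts of f. *)
have partE (g : borel_rV R n -> \bar R) : measurable_fun setT g -> (forall x, 0 <= g x)%E ->
  (\int[mscale c P]_(x in (euclidean_sphere R n `&` T : set (borel_rV R n))) g x =
   m%:R%:E * \int[mu]_(y in (@punctured_ball R m : set (borel_rV R m))) g (direction B y))%E.
  move=> mg g0; rewrite ge0_integral_mscale//; last exact: measurable_funTS.
  congr (_ * _)%E; rewrite /P ge0_integral_pushforward//.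
  - rewrite ball_direction_sphere//; apply: eq_integral => y /set_mem Dy /=.
    by rewrite /ball_direction indicE mem_set// scale1r.
  - exact: measurable_ball_direction.
  - exact: measurable_funTS.
rewrite integralE partE; [|exact: measurable_funepos|by move=> x; exact: funepos_ge0].
rewrite partE; [|exact: measurable_funeneg|by move=> x; exact: funeneg_ge0].
have posfin : (\int[mu]_(y in (@punctured_ball R m : set (borel_rV R m)))
    (EFin \o f)^\+ (direction B y))%E \is a fin_num.
  have := integrable_fin_num mDe (integrable_funepos mDe intf).
  by congr (_ \is a fin_num); apply: eq_integral => y _; rewrite !funeposE.
rewrite -muleBr//.
  congr (_ * _)%E; rewrite [RHS]integralE.
  by congr (_ - _)%E; apply: eq_integral => y _; rewrite ?funeposE ?funenegE.
exact: fin_num_adde_defr posfin.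
Qed.

(** * Volume in polar coordinates *)

Lemma root_gt1 (R : realType) (n : nat) (e : R) : (0 < n)%N -> 0 < e ->
  exists2 q : R, 1 < q & q ^+ n = 1 + e.
Proof.
move=> n0 e0; exists ((1 + e) `^ n%:R^-1).
  have {1}-> : 1 = 1 `^ n%:R^-1 :> R by rewrite powR1.
  by rewrite gt0_ltr_powR ?invr_gt0 ?ltr0n// ?nnegrE ?ltrDl// addr_ge0// ltW.
by rewrite -powR_mulrn ?powR_ge0// -powRrM mulVf ?pnatr_eq0 -?lt0n// powRr1// addr_ge0// ltW.
Qed.

(** Bernoulli: q ^+ N >= 1 + N (q - 1). *)
Lemma expr_unbounded (R : realType) (q b : R) : 1 < q -> exists N, b < q ^+ N.
Proof.
move=> q1; have d0 : 0 < q - 1 by rewrite subr_gt0.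
have bern N : 1 + (q - 1) * N%:R <= q ^+ N.
  elim: N => [|N IH]; first by rewrite mulr0 addr0 expr0.
  rewrite exprS -natr1 mulrDr mulr1 addrA (le_trans (lerD IH (lexx _)))//.
  have qN1 : 1 <= q ^+ N by rewrite exprn_ege1// ltW.
  by nra.
exists (Num.bound (b / (q - 1))).
have [b0|b0] := leP b 0; first by rewrite (le_lt_trans b0)// exprn_gt0// (lt_trans ltr01).
apply: lt_le_trans (bern _); rewrite ltr_wpDl// mulrC -ltr_pdivrMr//.
by rewrite archi_boundP// divr_ge0// ltW.
Qed.

(** For a degree 0 homogeneous function g with values in a compact subset of
    ]0, +oo[, the star-shaped set of the nonzero x with |x| <= g x has volume the
    integral of g^n over the unit ball, for every measure that scales like
    Lebesgue measure and is finite on the ball.  On a cone where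
    a <= g < a q, both the volume and the integral lie between a^n v and q^n a^n v,
    where v is the volume of the part of the cone in the unit ball ([cell]).
    Cutting the space into finitely many such cones shows that volume and integral
    differ by a factor at most q^n ([step]), and q is then sent to 1. *)
Section polar.
Variables (R : realType) (n : nat) (mu : {measure set (borel_rV R n) -> \bar R}).
Hypothesis muZ : forall (t : R) (A : set (borel_rV R n)), 0 < t -> measurable A ->
  (mu [set x | A (t *: (x : 'rV[R]_n))] = (t ^- n)%:E * mu A)%E.
Variable g : 'rV[R]_n -> R.
Hypothesis mg : measurable_fun [set: borel_rV R n] g.
Hypothesis gZ : forall t x, 0 < t -> g (t *: x) = g x.

Let D : set (borel_rV R n) := @punctured_ball R n.

Let mD : measurable D := @measurable_punctured_ball R n.

Let conic (A : set 'rV[R]_n) := forall t x, 0 < t -> A x -> A (t *: x).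

Let body : set (borel_rV R n) := [set x | 0 < enorm x <= g x].

Let mbody : measurable body.
Proof.
rewrite (_ : body = (@enorm R n @^-1` `]0, +oo[%classic) `&`
   ((fun x => g x - enorm x) @^-1` `[0, +oo[%classic)).
  apply: measurableI; rewrite -[X in measurable X]setTI.
    by apply: measurable_enorm => //; exact: measurable_itv.
  have : measurable_fun [set: borel_rV R n] (fun x => g x - enorm x).
    by apply: measurable_funB => //; exact: measurable_enorm.
  by apply => //; exact: measurable_itv.
by apply/seteqP; split=> x /=; rewrite !in_itv/= !andbT subr_ge0 => /andP.
Qed.

Let mu_conic (A : set (borel_rV R n)) (t : R) : conic A -> measurable A -> 0 < t ->
  (mu (A `&` [set x | (0 < enorm x <= t)%R]) = (t ^+ n)%:E * mu (A `&` D))%E.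
Proof.
move=> cA mA t0; have t'0 : 0 < t^-1 by rewrite invr_gt0.
rewrite -[t in RHS]invrK exprVn -muZ//; last exact: measurableI.
congr (mu _); apply/seteqP; split=> x [Ax] /= xt.
  split; first exact: cA.
  move: xt; rewrite /D /punctured_ball /= enormZ gtr0_norm// pmulr_rgt0// => /andP[-> xt] /=.
  by rewrite mulrC ler_pdivrMr// mul1r.
split; first by rewrite -(scale1r x) -(mulfV (lt0r_neq0 t0)) -scalerA; exact: cA.
move: xt; rewrite /D /punctured_ball /= enormZ gtr0_norm// pmulr_rgt0// => /andP[-> xt] /=.
by rewrite mulrC ler_pdivrMr// mul1r in xt.
Qed.

Let cell (A : set (borel_rV R n)) (a q : R) : conic A -> measurable A -> 0 < a -> 1 < q ->
  (forall x, A x -> a <= g x < a * q) ->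
  [/\ ((a ^+ n)%:E * mu (A `&` D) <= mu (A `&` body))%E,
      (mu (A `&` body) <= (q ^+ n)%:E * ((a ^+ n)%:E * mu (A `&` D)))%E,
      ((a ^+ n)%:E * mu (A `&` D) <= \int[mu]_(x in A `&` D) (g x ^+ n)%:E)%E &
      (\int[mu]_(x in A `&` D) (g x ^+ n)%:E <= (q ^+ n)%:E * ((a ^+ n)%:E * mu (A `&` D)))%E].
Proof.
move=> cA mA a0 q1 Ag; have aq0 : 0 < a * q by rewrite mulr_gt0// (lt_trans ltr01).
have mAD : measurable (A `&` D) by exact: measurableI.
have mball t : measurable (A `&` [set x : borel_rV R n | 0 < enorm x <= t]).
  apply: measurableI => //.
  rewrite (_ : [set _ | _] = (@enorm R n @^-1` `]0, t]%classic)).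
    by rewrite -[X in measurable X]setTI; apply: measurable_enorm => //; exact: measurable_itv.
  by apply/seteqP; split=> x /=; rewrite in_itv.
have mgn : measurable_fun (A `&` D) (fun x => (g x ^+ n)%:E).
  by apply/measurable_EFinP; apply: measurable_funTS; exact: measurable_funX.
have gn0 x : (A `&` D) x -> (0 <= (g x ^+ n)%:E)%E.
  by move=> [/Ag /andP[ag _] _]; rewrite lee_fin exprn_ge0// (le_trans (ltW a0)).
rewrite muleA -EFinM -exprMn [q * a]mulrC -(mu_conic cA mA a0) -(mu_conic cA mA aq0); split.
- apply: le_measure; rewrite ?inE//; first exact: measurableI.
  move=> x [Ax /= /andP[x0 xa]]; split => //; rewrite /body /= x0 /=.
  by have /andP[ag _] := Ag _ Ax; exact: le_trans xa ag.
- apply: le_measure; rewrite ?inE//; first exact: measurableI.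
  move=> x [Ax /= /andP[x0 xg]]; split => //; rewrite /= x0 /=.
  by have /andP[_ gq] := Ag _ Ax; rewrite (le_trans xg)// ltW.
- rewrite mu_conic// -integral_cst//; apply: ge0_le_integral => //=.
  + by move=> x _; rewrite lee_fin exprn_ge0// ltW.
  + move=> x [Ax _]; have /andP[ag _] := Ag _ Ax.
    by rewrite lee_fin; apply: lerXn2r; rewrite ?nnegrE ?(ltW a0) ?(le_trans (ltW a0)).
- rewrite mu_conic// -integral_cst//; apply: ge0_le_integral => //=.
  + move=> x [Ax _]; have /andP[ag gq] := Ag _ Ax.
    rewrite lee_fin; apply: lerXn2r; rewrite ?nnegrE ?(ltW gq) ?(ltW aq0)//.
    exact: le_trans (ltW a0) ag.
Qed.

Let step (N : nat) (A : set (borel_rV R n)) (a q : R) : conic A -> measurable A ->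
  0 < a -> 1 < q -> (forall x, A x -> a <= g x < a * q ^+ N) ->
  ((mu (A `&` body) <= (q ^+ n)%:E * \int[mu]_(x in A `&` D) (g x ^+ n)%:E) /\
   (\int[mu]_(x in A `&` D) (g x ^+ n)%:E <= (q ^+ n)%:E * mu (A `&` body)))%E.
Proof.
move=> + + + q1; have q0 := lt_trans ltr01 q1.
elim: N A a => [|N IH] A a cA mA a0 Ag.
  have -> : A = set0.
    apply/seteqP; split=> x // /Ag /andP[h1 h2]; have := le_lt_trans h1 h2.
    by rewrite expr0 mulr1 ltxx.
  by rewrite !set0I measure0 integral_set0 mule0.
(* A1 is one cell, and the values of g on A2 start at a q. *)
pose A1 : set (borel_rV R n) := A `&` [set x | g x < a * q].
pose A2 : set (borel_rV R n) := A `&` [set x | a * q <= g x].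
have mA1 : measurable A1.
  apply: measurableI => //; rewrite (_ : [set _ | _] = (g @^-1` `]-oo, a * q[%classic)).
    by rewrite -[X in measurable X]setTI; apply: mg => //; exact: measurable_itv.
  by apply/seteqP; split=> x /=; rewrite in_itv.
have mA2 : measurable A2.
  apply: measurableI => //; rewrite (_ : [set _ | _] = (g @^-1` `[a * q, +oo[%classic)).
    by rewrite -[X in measurable X]setTI; apply: mg => //; exact: measurable_itv.
  by apply/seteqP; split=> x /=; rewrite in_itv/= andbT.
have cA1 : conic A1 by move=> t x t0 [Ax gx]; split; [exact: cA|rewrite /= gZ].
have cA2 : conic A2 by move=> t x t0 [Ax gx]; split; [exact: cA|rewrite /= gZ].
have AE : A = A1 `|` A2.
  apply/seteqP; split=> [x Ax|x [[]|[]]//].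
  by have [h|h] := leP (a * q) (g x); [right|left].
have A12 : [disjoint A1 & A2].
  apply/disj_setPS => x [[_ /= h1] [_ /= h2]].
  by have := lt_le_trans h1 h2; rewrite ltxx.
have A1g x : A1 x -> a <= g x < a * q by move=> [/Ag /andP[-> _]].
have [c1 c2 c3 c4] := cell cA1 mA1 a0 q1 A1g.
have [i1 i2] : ((mu (A2 `&` body) <= (q ^+ n)%:E * \int[mu]_(x in A2 `&` D) (g x ^+ n)%:E) /\
   (\int[mu]_(x in A2 `&` D) (g x ^+ n)%:E <= (q ^+ n)%:E * mu (A2 `&` body)))%E.
  apply: (IH A2 (a * q)) => //; first exact: mulr_gt0.
  by move=> x [/Ag /andP[_ h] h2]; rewrite h2 -mulrA -exprS.
have gn0 x : (A `&` D) x -> (0 <= (g x ^+ n)%:E)%E.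
  by move=> [/Ag /andP[ag _] _]; rewrite lee_fin exprn_ge0// (le_trans (ltW a0)).
have qn0 : (0 < (q ^+ n)%:E :> \bar R)%E by rewrite lte_fin exprn_gt0.
have -> : mu (A `&` body) = (mu (A1 `&` body) + mu (A2 `&` body))%E.
  rewrite {1}AE setIUl measureU//; [exact: measurableI|exact: measurableI|].
  by rewrite setIACA (disj_set2P A12) set0I.
have -> : (\int[mu]_(x in A `&` D) (g x ^+ n)%:E = \int[mu]_(x in A1 `&` D) (g x ^+ n)%:E
    + \int[mu]_(x in A2 `&` D) (g x ^+ n)%:E)%E.
  rewrite {1}AE setIUl ge0_integral_setU//; [exact: measurableI|exact: measurableI| | |].
  - apply/measurable_EFinP; apply: measurable_funTS; exact: measurable_funX.
  - by rewrite -setIUl -AE.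
  - apply/disj_setPS => x [[h1 _] [h2 _]].
    by have /disj_setPS := A12; apply; split; [exact: h1|exact: h2].
have iA1 : (0 <= \int[mu]_(x in A1 `&` D) (g x ^+ n)%:E)%E.
  by apply: integral_ge0 => x [[Ax _] Dx]; exact: gn0.
have iA2 : (0 <= \int[mu]_(x in A2 `&` D) (g x ^+ n)%:E)%E.
  by apply: integral_ge0 => x [[Ax _] Dx]; exact: gn0.
rewrite (ge0_muleDr _ iA1 iA2).
rewrite (ge0_muleDr _ (measure_ge0 mu (A1 `&` body)) (measure_ge0 mu (A2 `&` body))).
split; apply: leeD => //.
  by apply: (le_trans c2); rewrite lee_pmul2l.
by apply: (le_trans c4); rewrite lee_pmul2l.
Qed.

Lemma polar_volume (a b : R) : (0 < n)%N -> (mu D < +oo)%E -> 0 < a -> 0 <= b ->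
  (forall x, x != 0 -> a <= g x <= b) ->
  mu [set x | 0 < enorm x <= g x] = (\int[mu]_(x in D) (g x ^+ n)%:E)%E.
Proof.
move=> n0 Dfin a0 b0 gab.
set I := (\int[mu]_(x in D) _)%E; set v := mu _.
pose U : set (borel_rV R n) := [set x | x != 0].
have mU : measurable U.
  rewrite (_ : U = (@enorm R n @^-1` `]0, +oo[%classic)).
    by rewrite -[X in measurable X]setTI; apply: measurable_enorm => //; exact: measurable_itv.
  by apply/seteqP; split=> x /=; rewrite in_itv/= andbT enorm_gt0.
have cU : conic U by move=> t x t0 /=; rewrite /U /= scaler_eq0 negb_or gt_eqF.
have UD : U `&` D = D.
  by apply: setIidr => x /andP[x0 _]; rewrite /U /= -enorm_gt0.
have Ur : U `&` body = body.
  by apply: setIidr => x /andP[x0 _]; rewrite /U /= -enorm_gt0.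
have Ifin : I \is a fin_num.
  rewrite ge0_fin_numE; last first.
    apply: integral_ge0 => x Dx; rewrite lee_fin exprn_ge0// (le_trans (ltW a0))//.
    by have /gab /andP[] : x != 0 by rewrite -enorm_gt0; case/andP: Dx.
  apply: (@le_lt_trans _ _ (\int[mu]_(x in D) (b ^+ n)%:E)%E).
    apply: ge0_le_integral => //.
    - move=> x Dx; rewrite lee_fin exprn_ge0// (le_trans (ltW a0))//.
      by have /gab /andP[] : x != 0 by rewrite -enorm_gt0; case/andP: Dx.
    - by apply/measurable_EFinP; apply: measurable_funTS; exact: measurable_funX.
    - move=> x Dx; have /gab /andP[ag gb] : x != 0 by rewrite -enorm_gt0; case/andP: Dx.
      have g0 := lt_le_trans a0 ag.
      by rewrite lee_fin; apply: lerXn2r; rewrite ?nnegrE ?(ltW g0) ?(le_trans (ltW g0) gb).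
  by rewrite integral_cst// lte_mul_pinfty ?lee_fin ?exprn_ge0.
have bracket (e : R) : 0 < e -> ((v <= (1 + e)%:E * I) /\ (I <= (1 + e)%:E * v))%E.
  move=> e0; have [q q1 qE] := root_gt1 n0 e0.
  have [N bN] := expr_unbounded (b / a) q1.
  rewrite -qE; have := @step N U a q cU mU a0 q1; rewrite UD Ur; apply.
  move=> x /gab /andP[-> gb] /=; apply: le_lt_trans gb _.
  by rewrite mulrC -ltr_pdivrMr.
have vfin : v \is a fin_num.
  rewrite ge0_fin_numE ?measure_ge0//; apply: le_lt_trans (proj1 (bracket _ ltr01)) _.
  by rewrite -(fineK Ifin) -EFinM ltry.
rewrite -(fineK Ifin) -(fineK vfin); congr EFin.
have I0 : 0 <= fine I.
  rewrite fine_ge0//; apply: integral_ge0 => x Dx.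
  rewrite lee_fin exprn_ge0// (le_trans (ltW a0))//.
  by have /gab /andP[] : x != 0 by rewrite -enorm_gt0; case/andP: Dx.
have v0 : 0 <= fine v by rewrite fine_ge0// measure_ge0.
have aux (r s : R) : 0 <= s -> (forall e, 0 < e -> r <= (1 + e) * s) -> r <= s.
  move=> s0 h; apply/ler_addgt0Pr => e e0.
  have s1 : 0 < s + 1 by rewrite ltr_wpDl.
  apply: le_trans (h (e / (s + 1)) (divr_gt0 e0 s1)) _.
  rewrite mulrDl mul1r lerD2l mulrAC ler_pdivrMr// ler_pM2l//.
  by rewrite lerDl.
apply/eqP; rewrite eq_le; apply/andP; split; apply: aux => // e /bracket [h1 h2].
  by rewrite -lee_fin EFinM !fineK.
by rewrite -lee_fin EFinM !fineK.
Qed.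

End polar.

(** * Star bodies and their gauges *)

(** Otherwise K and its interior would cut out the same subset of the segment, which
    would be both open and closed in it. *)
Lemma segment_boundary (R : realType) (n : nat) (K : set 'rV[R]_n) (u : 'rV[R]_n)
    (a b s r : R) : closed K -> s \in `[a, b] -> r \in `[a, b] ->
  K (s *: u) -> ~ K (r *: u) ->
  exists2 c : R, c \in `[a, b] & boundary K (c *: u).
Proof.
move=> cK sab rab Ks Kr; apply: contrapT => nob; apply: Kr.
have /continuousP cf : continuous (fun t : R => t *: u) by exact: scalel_continuous.
have cf' : continuous (fun t : R => t *: u) by exact: scalel_continuous.
pose B := `[a, b]%classic `&` (fun t : R => t *: u) @^-1` K.
suff BE : B = `[a, b]%classic by have [] : B r by rewrite BE.
apply: segment_connected; first by exists s; split.
  exists ((fun t : R => t *: u) @^-1` K°); first by apply: cf; exact: open_interior.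
  apply/seteqP; split=> t [tab Kt]; split=> //; last exact: interior_subset Kt.
  apply: contrapT => Kot; apply: nob; exists t => //.
  by split=> //; exact: subset_closure.
exists ((fun t : R => t *: u) @^-1` K) => //.
by move/continuous_closedP : cf'; apply.
Qed.

(** If x is in K but t x is not, the line through x meets the boundary once between
    0 and t x, once between t x and x, and once on the opposite ray, which leaves
    the bounded set K.  That is one point too many. *)
Lemma star_shaped (R : realType) (n : nat) (K : set 'rV[R]_n) (x : 'rV[R]_n) (t : R) :
  star_body K -> K x -> 0 <= t <= 1 -> K (t *: x).
Proof.
move=> [cK bK twoK K0 _] Kx /andP[t0 t1].
have [->|x0] := eqVneq x 0; first by rewrite scaler0; exact: interior_subset.
apply: contrapT => nKt.
have tn0 : t != 0 by apply/eqP => t00; apply: nKt; rewrite t00 scale0r; exact: interior_subset.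
have {tn0}t0 : 0 < t by rewrite lt_neqAle eq_sym tn0.
have bdK y : boundary K y -> K y by case; rewrite -(closure_id K).1.
have bd0 c : boundary K (c *: x) -> c != 0.
  by move=> [_ nint]; apply/eqP => c0; apply: nint; rewrite c0 scale0r.
have [C C0 KC] := ex_strict_bound_gt0 (bK : bounded_near id _).
have [s s0 nKs] : exists2 s : R, s < 0 & ~ K (s *: x).
  have nx0 : 0 < `|x| by rewrite normr_gt0.
  exists (- (C / `|x|)); first by rewrite oppr_lt0 divr_gt0.
  by move=> /KC /=; rewrite normrZ normrN gtr0_norm ?divr_gt0// divfK ?gt_eqF// ltxx.
have Kz : K (0 *: x) by rewrite scale0r; exact: interior_subset.
have K1 : K (1 *: x) by rewrite scale1r.
have [c1 c1s b1] : exists2 c : R, c \in `[0, t] & boundary K (c *: x).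
  by apply: (segment_boundary cK _ _ Kz nKt); rewrite in_itv/= ?lexx ltW.
have [c2 c2s b2] : exists2 c : R, c \in `[t, 1] & boundary K (c *: x).
  by apply: (segment_boundary cK _ _ K1 nKt); rewrite in_itv/= ?lexx ?t1.
have [c3 c3s b3] : exists2 c : R, c \in `[s, 0] & boundary K (c *: x).
  by apply: (segment_boundary cK _ _ Kz nKs); rewrite in_itv/= ?lexx ltW.
move: c1s c2s c3s; rewrite !in_itv/= => /andP[c10 c1t] /andP[c2t c21] /andP[_ c30].
have c1t' : c1 < t.
  rewrite lt_neqAle c1t andbT; apply/eqP => ct; apply: nKt; rewrite -ct; exact: bdK.
have c2t' : t < c2.
  rewrite lt_neqAle c2t andbT; apply/eqP => ct; apply: nKt; rewrite ct; exact: bdK.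
have c10' : 0 < c1 by rewrite lt_neqAle c10 eq_sym bd0.
have c30' : c3 < 0 by rewrite lt_neqAle c30 bd0.
have [p [q [pq E]]] := twoK x x0.
have inE c : boundary K (c *: x) -> c *: x = p \/ c *: x = q.
  move=> bc; suff : [set p; q] (c *: x) by [].
  rewrite -E; split; first by split=> //; exists c.
  by move=> /eqP; rewrite scaler_eq0 (negbTE x0) orbF (negbTE (bd0 _ bc)).
have inj c d : c *: x = d *: x -> c = d.
  by move=> cd; apply/eqP; rewrite -subr_eq0; move/eqP: cd;
     rewrite -subr_eq0 -scalerBl scaler_eq0 (negbTE x0) orbF.
have c12 : c1 <> c2 by move=> e; move: (lt_trans c1t' c2t'); rewrite e ltxx.
have c13 : c1 <> c3 by move=> e; move: (lt_trans c30' c10'); rewrite e ltxx.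
have c23 : c2 <> c3.
  by move=> e; move: (lt_trans c30' (lt_trans t0 c2t')); rewrite e ltxx.
have [e1|e1] := inE _ b1; have [e2|e2] := inE _ b2; have [e3|e3] := inE _ b3;
  by [apply: c12; apply: inj; rewrite e1 e2 | apply: c13; apply: inj; rewrite e1 e3
     | apply: c23; apply: inj; rewrite e2 e3].
Qed.

(** The bounds use the sup norm; any other norm would define the same notion. *)
Definition gauge (R : realType) (n : nat) (M : 'rV[R]_n -> R) :=
  [/\ continuous M, (forall t x, 0 < t -> M (t *: x) = t * M x),
      (exists2 c : R, 0 < c & forall x, c * `|x| <= M x) &
      (exists2 c : R, 0 < c & forall x, M x <= c * `|x|)].

Section minkowski.
Variables (R : realType) (n : nat) (K : set 'rV[R]_n).
Hypothesis sK : star_body K.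

Let S (x : 'rV[R]_n) := [set a : R | 0 <= a /\ [set a *: y | y in K] x].

Let S_gt0 x a : 0 < a -> K (a^-1 *: x) -> S x a.
Proof.
move=> a0 Kx; split; first exact: ltW.
by exists (a^-1 *: x) => //; rewrite scalerA mulfV ?gt_eqF// scale1r.
Qed.

Let S_lb x : has_lbound (S x).
Proof. by exists 0 => a []. Qed.

Let minkowski_le x a : S x a -> minkowski_functional K x <= a.
Proof. by move=> Sxa; apply: ge_inf => //; exact: S_lb. Qed.

Lemma minkowski_upper :
  exists2 c : R, 0 < c & forall x, minkowski_functional K x <= c * `|x| /\ S x !=set0.
Proof.
have [_ _ _ K0 _] := sK.
have /nbhs_ballP [r /= r0 rK] := K0.
have rS x a : r^-1 * `|x| < a -> S x a.
  move=> xa; have a0 : 0 < a by apply: le_lt_trans xa; rewrite mulr_ge0// invr_ge0 ltW.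
  apply: S_gt0 => //; apply: rK; rewrite -ball_normE /= sub0r normrN normrZ.
  rewrite gtr0_norm ?invr_gt0// mulrC ltr_pdivrMr//.
  by rewrite -ltr_pdivrMl.
exists r^-1 => [|x]; first by rewrite invr_gt0.
split; last by exists (r^-1 * `|x| + 1); apply: rS; rewrite ltrDl.
by apply/ler_addgt0Pr => e e0; apply: minkowski_le; apply: rS; rewrite ltrDl.
Qed.

Let S_neq0 x : S x !=set0.
Proof. by have [c _ h] := minkowski_upper; have [] := h x. Qed.

Lemma minkowski_lower :
  exists2 c : R, 0 < c & forall x, c * `|x| <= minkowski_functional K x.
Proof.
have [_ bK _ _ _] := sK.
have [C C0 KC] := ex_strict_bound_gt0 (bK : bounded_near id _).
exists C^-1 => [|x]; first by rewrite invr_gt0.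
apply: lb_le_inf; first exact: S_neq0.
move=> a [a0 [y Ky <-]]; rewrite normrZ ger0_norm// mulrC ler_pdivrMr//.
by rewrite ler_wpM2l// ltW//; exact: KC.
Qed.

Lemma minkowskiZ t x : 0 < t ->
  minkowski_functional K (t *: x) = t * minkowski_functional K x.
Proof.
have le s y : 0 < s -> minkowski_functional K (s *: y) <= s * minkowski_functional K y.
  move=> s0; rewrite -ler_pdivrMl//; apply: lb_le_inf; first exact: S_neq0.
  move=> a [a0 [z Kz <-]]; rewrite ler_pdivrMl//; apply: minkowski_le.
  by split; [rewrite mulr_ge0// ltW|exists z => //; rewrite scalerA].
move=> t0; apply/eqP; rewrite eq_le le//= -ler_pdivlMl//.
by rewrite -{1}(scale1r x) -(mulVf (lt0r_neq0 t0)) -scalerA le// invr_gt0.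
Qed.

Lemma gauge_minkowski : gauge (minkowski_functional K).
Proof.
split; [by case: sK|by move=> t x; exact: minkowskiZ|exact: minkowski_lower|].
by have [c c0 h] := minkowski_upper; exists c => // x; have [] := h x.
Qed.

(** If the gauge of x is at most 1, star-shapedness gives t x in K for all t < 1, and
    K is closed. *)
Lemma minkowski_le1 : K = [set x | minkowski_functional K x <= 1].
Proof.
have [cK _ _ K0 _] := sK.
apply/seteqP; split=> x.
  by move=> Kx; apply: minkowski_le; apply: S_gt0 => //; rewrite invr1 scale1r.
move=> /= Mx; have [->|x0] := eqVneq x 0; first exact: interior_subset.
have Kt t : 0 < t < 1 -> K (t *: x).
  move=> /andP[t0 t1].
  have Mt : minkowski_functional K x < t^-1 by rewrite (le_lt_trans Mx)// invf_gt1.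
  have [a [a0 [y Ky yE]] at_] := inf_lt (S_neq0 x) Mt.
  rewrite -yE scalerA; apply: star_shaped => //.
  have a0' : 0 < a.
    by rewrite lt_neqAle a0 andbT eq_sym; apply: contraNneq x0 => a00; rewrite -yE a00 scale0r.
  by rewrite mulr_ge0 ?(ltW t0)//= mulrC -ler_pdivlMr// mul1r ltW.
apply: contrapT => nK.
have cf : continuous (fun t : R => t *: x) by exact: scalel_continuous.
have cP : closed ((fun t : R => t *: x) @^-1` K) by move/continuous_closedP : cf; apply.
have oP := closed_openC cP.
have P1 : (~` ((fun t : R => t *: x) @^-1` K)) 1 by rewrite /= scale1r.
have /nbhs_ballP [d /= d0 dP] := open_nbhs_nbhs (conj oP P1).
pose t := Num.max 2^-1 (1 - d / 2).
have t1 : t < 1 by rewrite /t gt_max; apply/andP; split; lra.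
have t0 : 0 < t by rewrite /t lt_max invr_gt0 ltr0n.
apply: (dP t); last by apply: Kt; rewrite t0.
rewrite -ball_normE /= ger0_norm ?subr_ge0 ?ltW//.
have : 1 - d / 2 <= t by rewrite /t le_max lexx orbT.
by move=> h; lra.
Qed.

End minkowski.

(** * Orthonormal bases *)

Lemma mulmx_in_vspace (R : realType) (m n : nat) (U : {vspace 'rV[R]_n})
    (B : 'M[R]_(m, n)) (y : 'rV[R]_m) :
  (forall i, row i B \in U) -> y *m B \in U.
Proof.
by move=> BU; rewrite mulmx_sum_row; apply: memv_suml => i _; rewrite memvZ.
Qed.

(** Gram-Schmidt: k orthonormal rows in U with k < dim U do not span U, and a vector
    of U outside of their span, minus its projection, can be normalized. *)
Lemma orthonormal_rows (R : realType) (n k : nat) (U : {vspace 'rV[R]_n}) :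
  (k <= \dim U)%N ->
  exists B : 'M[R]_(k, n), B *m B^T = 1%:M /\ forall i, row i B \in U.
Proof.
elim: k => [_|k IH kU].
  by exists 0; split=> [|[]//]; apply/matrixP => -[].
have [B [BB BU]] := IH (ltnW kU).
pose W := <<[seq row i B | i <- enum 'I_k]>>%VS.
have BW i : row i B \in W.
  by apply: memv_span; apply: map_f; rewrite mem_enum.
have /subvPn [v vU vW] : ~~ (U <= W)%VS.
  apply/negP => /dimvS; rewrite leqNgt => /negP; apply.
  by apply: leq_ltn_trans (dim_span _) _; rewrite size_map size_enum_ord.
pose w := v - v *m B^T *m B.
have wU : w \in U by rewrite rpredB// mulmx_in_vspace.
have wB : w *m B^T = 0 by rewrite mulmxBl -!mulmxA BB mulmx1 subrr.
have w0 : 0 < enorm w.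
  rewrite enorm_gt0 subr_eq0; apply: contraNneq vW => ->.
  exact: mulmx_in_vspace.
pose e := (enorm w)^-1 *: w.
have eB : e *m B^T = 0 by rewrite -scalemxAl wB scaler0.
have ee : e *m e^T = 1%:M.
  apply/matrixP => i j; rewrite !ord1 mxE [RHS]mxE eqxx.
  have -> : \sum_(l < n) e 0 l * e^T l 0 = enorm e ^+ 2.
    by rewrite sqr_enorm; apply: eq_bigr => l _; rewrite [e^T _ _]mxE expr2.
  by rewrite /e enormZ ger0_norm ?invr_ge0 ?enorm_ge0// mulVf ?gt_eqF// expr1n.
have CC : col_mx e B *m (col_mx e B)^T = 1%:M.
  rewrite tr_col_mx mul_col_row ee eB BB.
  have -> : B *m e^T = 0 by rewrite -[LHS]trmxK trmx_mul trmxK eB trmx0.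
  by rewrite -scalar_mx_block.
exists (col_mx e B : 'M[R]_(1 + k, n)); split; first exact: CC.
move=> i; case: (@split_ordP 1 k i) => j ->.
  by rewrite (@rowKu _ 1 k) row_id memvZ.
by rewrite (@rowKd _ 1 k).
Qed.

Lemma orthonormal_basis_neq0 (R : realType) (n m : nat) (H : grassmannian R n m) :
  orthonormal_basis H (xget 0 (orthonormal_basis H)).
Proof.
apply: xgetPex; have /eqP dH := valP H.
have [|B [BB BH]] := @orthonormal_rows R n m (val H); first by rewrite dH.
by exists B.
Qed.

(** * Hoelder's inequality for powers of bounded functions *)

(** Young's inequality for x^k and y^m with the conjugate exponents (k + m) / k and
    (k + m) / m. *)
Lemma weighted_AM_GM (R : realType) (k m : nat) (x y : R) :
  (0 < k)%N -> (0 < m)%N -> 0 <= x -> 0 <= y ->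
  x ^+ k * y ^+ m <=
    k%:R / (k + m)%:R * x ^+ (k + m) + m%:R / (k + m)%:R * y ^+ (k + m).
Proof.
move=> k0 m0 x0 y0; set n := (k + m)%N.
have n0 : 0 < n%:R :> R by rewrite ltr0n addn_gt0 k0.
have k0' : 0 < k%:R :> R by rewrite ltr0n.
have m0' : 0 < m%:R :> R by rewrite ltr0n.
have := @conjugate_powR R (x ^+ k) (y ^+ m) (n%:R / k%:R) (n%:R / m%:R).
have powE (z : R) (j : nat) : 0 <= z -> (0 < j)%N -> (z ^+ j) `^ (n%:R / j%:R) = z ^+ n.
  move=> z0 j0; rewrite -powR_mulrn// -powRrM mulrCA mulfV ?pnatr_eq0 -?lt0n//.
  by rewrite mulr1 powR_mulrn.
rewrite !powE// !invf_div [X in _ <= X + _]mulrC [X in _ <= _ + X]mulrC; apply.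
- exact: exprn_ge0.
- exact: exprn_ge0.
- exact: divr_gt0.
- exact: divr_gt0.
- by rewrite -mulrDl -natrD mulfV// gt_eqF.
Qed.

Lemma normalized_young (R : realType) (k m : nat) (x y a c A B : R) :
  (0 < k)%N -> (0 < m)%N -> 0 <= x -> 0 <= y -> 0 < a -> 0 < c ->
  a ^+ (k + m) = A -> c ^+ (k + m) = B ->
  (a ^+ k * c ^+ m)^-1 * (x ^+ k * y ^+ m) <=
    k%:R / (k + m)%:R / A * x ^+ (k + m) +
    m%:R / (k + m)%:R / B * y ^+ (k + m).
Proof.
move=> k0 m0 x0 y0 a0 c0 <- <-.
have := weighted_AM_GM k0 m0 (divr_ge0 x0 (ltW a0)) (divr_ge0 y0 (ltW c0)).
have swap (u v w : R) : u * (v * w) = u * w * v by rewrite mulrA mulrAC.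
move: (k + m)%N => n.
rewrite !expr_div_n [leLHS]mulrACA -invfM [leLHS]mulrC.
by rewrite (swap (k%:R / n%:R)) (swap (m%:R / n%:R)).
Qed.

Section bounded_Rintegral.
Context d (T : measurableType d) (R : realType).
Variables (mu : {measure set T -> \bar R}) (D : set T).
Hypotheses (mD : measurable D) (Dfin : (mu D < +oo)%E).

Lemma bounded_integrable (f : T -> R) (b : R) : measurable_fun setT f ->
  (forall x, D x -> `|f x| <= b) -> mu.-integrable D (EFin \o f).
Proof.
move=> mf fb; apply: measurable_bounded_integrable => //; first exact: measurable_funTS.
exists b; split; [exact: num_real|move=> c bc x Dx].
by apply: le_trans (ltW bc); exact: fb.
Qed.

Lemma integrable_scale (r : R) (f : T -> R) : mu.-integrable D (EFin \o f) ->
  mu.-integrable D (EFin \o (fun x => r * f x)).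
Proof.
by move=> /(integrableZl mD r); apply: eq_integrable => // x _; rewrite /= EFinM.
Qed.

Lemma integrable_add (f g : T -> R) : mu.-integrable D (EFin \o f) ->
  mu.-integrable D (EFin \o g) -> mu.-integrable D (EFin \o (fun x => f x + g x)).
Proof.
by move=> fi gi; have := integrableD mD fi gi; apply: eq_integrable => // x _; rewrite /= EFinD.
Qed.

(** As usual, integrate Young's inequality for f and g divided by their norms of
    order k + m, here called a and c. *)
Lemma Rintegral_hoelder (k m : nat) (f g : T -> R) (b : R) :
  (0 < k)%N -> (0 < m)%N -> measurable_fun setT f -> measurable_fun setT g ->
  (forall x, D x -> 0 <= f x <= b) -> (forall x, D x -> 0 <= g x <= b) ->
  0 < \int[mu]_(x in D) (f x ^+ (k + m)) -> 0 < \int[mu]_(x in D) (g x ^+ (k + m)) ->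
  \int[mu]_(x in D) (f x ^+ k * g x ^+ m) <=
  (\int[mu]_(x in D) (f x ^+ (k + m))) `^ (k%:R / (k + m)%:R) *
  (\int[mu]_(x in D) (g x ^+ (k + m))) `^ (m%:R / (k + m)%:R).
Proof.
move=> k0 m0 mf mg fb gb; set n := (k + m)%N.
set A := \int[mu]_(x in D) _; set B := \int[mu]_(x in D) (g x ^+ n) => A0 B0.
have n0 : (0 < n)%N by rewrite addn_gt0 k0.
have nR : n%:R != 0 :> R by rewrite pnatr_eq0 -lt0n.
pose a := A `^ n%:R^-1; pose c := B `^ n%:R^-1.
have a0 : 0 < a by rewrite powR_gt0.
have c0 : 0 < c by rewrite powR_gt0.
have an : a ^+ n = A by rewrite -powR_mulrn ?ltW// -powRrM mulVf// powRr1// ltW.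
have cn : c ^+ n = B by rewrite -powR_mulrn ?ltW// -powRrM mulVf// powRr1// ltW.
have -> : A `^ (k%:R / n%:R) = a ^+ k.
  by rewrite -powR_mulrn ?ltW// -powRrM mulrC.
have -> : B `^ (m%:R / n%:R) = c ^+ m.
  by rewrite -powR_mulrn ?ltW// -powRrM mulrC.
have intX (h : T -> R) (j : nat) : measurable_fun setT h ->
    (forall x, D x -> 0 <= h x <= b) -> mu.-integrable D (EFin \o (fun x => h x ^+ j)).
  move=> mh hb; apply: (@bounded_integrable _ (b ^+ j)); first exact: measurable_funX.
  move=> x /hb /andP[h0 hb']; rewrite ger0_norm ?exprn_ge0//.
  by apply: lerXn2r; rewrite ?nnegrE// (le_trans h0).
have intP : mu.-integrable D (EFin \o (fun x => f x ^+ k * g x ^+ m)).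
  apply: (@bounded_integrable _ (b ^+ k * b ^+ m)).
    by apply: measurable_funM; exact: measurable_funX.
  move=> x Dx; have /andP[f0 fb'] := fb _ Dx; have /andP[g0 gb'] := gb _ Dx.
  rewrite ger0_norm ?mulr_ge0 ?exprn_ge0//.
  by apply: ler_pM; rewrite ?exprn_ge0//; apply: lerXn2r; rewrite ?nnegrE// (le_trans f0).
have ac0 : 0 < a ^+ k * c ^+ m := mulr_gt0 (exprn_gt0 k a0) (exprn_gt0 m c0).
rewrite -[leRHS]mulr1 -ler_pdivrMl// -RintegralZl//.
pose u := k%:R / n%:R / A; pose v := m%:R / n%:R / B.
apply: (@le_trans _ _ (\int[mu]_(x in D) (u * f x ^+ n + v * g x ^+ n))).
  apply: le_Rintegral => //.
  - exact: integrable_scale.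
  - by apply: integrable_add; apply: integrable_scale; exact: intX.
  move=> x Dx; have /andP[f0 _] := fb _ Dx; have /andP[g0 _] := gb _ Dx.
  exact: normalized_young k0 m0 f0 g0 a0 c0 an cn.
rewrite RintegralD//; try by apply: integrable_scale; exact: intX.
rewrite !RintegralZl//; [|exact: intX|exact: intX].
rewrite -/A -/B /u /v !mulfVK ?gt_eqF// -mulrDl -natrD mulfV//.
Qed.

End bounded_Rintegral.

(** * Radial functions, and the Euclidean ball *)

(** The radial function of the star body of the x with M x <= 1: on the unit sphere
    it is 1 / M, and it is extended to be homogeneous of degree 0. *)
Definition radial_function (R : realType) (n : nat) (M : 'rV[R]_n -> R) (x : 'rV[R]_n) : R :=
  enorm x / M x.

Section gauge_theory.
Variables (R : realType) (n : nat) (M : 'rV[R]_n -> R).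
Hypothesis gM : gauge M.

Lemma gauge_gt0 x : x != 0 -> 0 < M x.
Proof.
have [_ _ [c c0 h] _] := gM => x0; apply: lt_le_trans (h x).
by rewrite mulr_gt0// normr_gt0.
Qed.

Lemma gauge0 : M 0 = 0.
Proof.
have [_ _ [c _ h1] [e _ h2]] := gM; apply/eqP; rewrite eq_le.
by have := h1 0; have := h2 0; rewrite !normr0 !mulr0 => -> ->.
Qed.

Lemma gauge_ge0 x : 0 <= M x.
Proof.
by have [->|/gauge_gt0/ltW//] := eqVneq x 0; rewrite gauge0.
Qed.

Lemma measurable_gauge : measurable_fun [set: borel_rV R n] M.
Proof. by apply: continuous_borel_rV; case: gM. Qed.

Lemma measurable_gauge_inv : measurable_fun [set: borel_rV R n] (fun x => (M x)^-1).
Proof.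
apply: (@measurable_funV_ge0 _ (borel_rV R n)); [exact: gauge_ge0|exact: measurable_gauge].
Qed.

Lemma measurable_radial : measurable_fun [set: borel_rV R n] (radial_function M).
Proof.
by apply: measurable_funM; [exact: measurable_enorm|exact: measurable_gauge_inv].
Qed.

Lemma radialZ t x : 0 < t -> radial_function M (t *: x) = radial_function M x.
Proof.
have [_ MZ _ _] := gM.
by move=> t0; rewrite /radial_function enormZ MZ// gtr0_norm// invfM mulrACA mulfV ?gt_eqF// mul1r.
Qed.

(** The bounds depend on M only.  They thus hold for the sections of the body by all
    subspaces at once, which makes the set of gaps between sections bounded. *)
Lemma radial_bounds : exists a b : R, [/\ 0 < a, 0 <= b &
  forall x, x != 0 -> a <= radial_function M x <= b].
Proof.
have [_ _ [c c0 h1] [e e0 h2]] := gM.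
exists e^-1, (n%:R / c); split; first by rewrite invr_gt0.
  by rewrite divr_ge0// ltW.
move=> x x0; have Mx := gauge_gt0 x0; apply/andP; split.
  rewrite /radial_function ler_pdivlMr// ler_pdivrMl//.
  by apply: le_trans (h2 x) _; rewrite ler_pM2l// mx_norm_le_enorm.
rewrite /radial_function ler_pdivrMr//; apply: le_trans (enorm_le_mx_norm x) _.
by rewrite -mulrA ler_wpM2l// ler_pdivlMl.
Qed.

Lemma gauge_direction m (B : 'M[R]_(m, n)) y : B *m B^T = 1%:M ->
  @punctured_ball R m y -> (M (direction B y))^-1 = radial_function M (y *m B).
Proof.
have [_ MZ _ _] := gM.
move=> BB /andP[y0 _]; rewrite /direction MZ ?invr_gt0//.
by rewrite /radial_function enorm_mulmx// invfM invrK.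
Qed.

End gauge_theory.

Section lebesgue_facts.
Variables (R : realType) (n : nat) (mu : {sigma_finite_measure set (borel_rV R n) -> \bar R}).
Hypothesis muE : (mu : set (borel_rV R n) -> \bar R) = lebesgue_rV R n.
Hypothesis muc : forall r : R, 0 <= r -> mu (cube r) = ((2 * r) ^+ n)%:E.

Lemma set1_cube : [set 0] = @cube R n 0.
Proof.
apply/seteqP; split=> [x -> i|x h]; first by rewrite mxE normr0.
by apply/rowP => i; rewrite mxE; apply/eqP; rewrite -normr_le0; exact: h.
Qed.

Lemma measurable_zero : measurable ([set 0] : set (borel_rV R n)).
Proof. by rewrite set1_cube; exact: measurable_cube. Qed.

Lemma lebesgue_zero : (0 < n)%N -> mu [set 0] = 0%E.
Proof. by move=> n0; rewrite set1_cube muc// mulr0 expr0n eqn0Ngt n0. Qed.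

Lemma lebesgue_add_zero (A : set (borel_rV R n)) : (0 < n)%N -> measurable A ->
  mu (A `|` [set 0]) = mu A.
Proof.
by move=> n0 mA; apply: measureU0 => //; [exact: measurable_zero|exact: lebesgue_zero].
Qed.

Lemma punctured_ball_lt_pinfty : (mu (@punctured_ball R n) < +oo)%E.
Proof.
apply: (@le_lt_trans _ _ (mu (cube 1))); last by rewrite muc// ltry.
apply: le_measure; rewrite ?inE; [exact: measurable_punctured_ball|exact: measurable_cube|].
move=> x /andP[_ x1] i; apply: le_trans x1; apply: le_trans (mx_norm_le_enorm x).
exact: coord_le_mx_norm.
Qed.

Lemma euclidean_ball_punctured :
  euclidean_ball R n = @punctured_ball R n `|` [set 0].
Proof.
apply/seteqP; split=> x; rewrite /euclidean_ball /punctured_ball /=.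
  by have [->|] := eqVneq x 0; [right|rewrite -enorm_gt0 => -> ->; left].
by move=> [/andP[]//|->]; rewrite enorm0.
Qed.

Lemma vol_euclidean_ball : (0 < n)%N ->
  vol (euclidean_ball R n) = fine (mu (@punctured_ball R n)).
Proof.
move=> n0; rewrite /vol -muE euclidean_ball_punctured lebesgue_add_zero//.
exact: measurable_punctured_ball.
Qed.

Lemma vol_euclidean_ball_gt0 : (0 < n)%N -> 0 < vol (euclidean_ball R n).
Proof.
move=> n0; have nR : 0 < n%:R :> R by rewrite ltr0n.
have mb : measurable (euclidean_ball R n : set (borel_rV R n)).
  rewrite euclidean_ball_punctured; apply: measurableU; last exact: measurable_zero.
  exact: measurable_punctured_ball.
have fin : mu (euclidean_ball R n) \is a fin_num.
  rewrite ge0_fin_numE ?measure_ge0// euclidean_ball_punctured lebesgue_add_zero//.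
    exact: punctured_ball_lt_pinfty.
  exact: measurable_punctured_ball.
(* The Euclidean norm is at most n times the sup norm: the cube of half-side 1/n
   is inside the ball. *)
have cb : (2 / n%:R) ^+ n <= vol (euclidean_ball R n).
  rewrite /vol -muE -lee_fin fineK// -muc ?invr_ge0 ?ler0n//.
  apply: le_measure; rewrite ?inE//; first exact: measurable_cube.
  move=> x h /=; rewrite /euclidean_ball /=; apply: le_trans (enorm_le_mx_norm x) _.
  rewrite -ler_pdivlMl// mulr1 [leLHS]/Num.norm /= mx_normrE.
  apply/bigmax_leP; split; first by rewrite invr_ge0 ltW.
  by move=> [i j] _ /=; rewrite ord1; exact: h.
by apply: lt_le_trans cb; rewrite exprn_gt0// divr_gt0.
Qed.

End lebesgue_facts.

(** * Volumes and Radon transforms as integrals over the unit ball *)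

Section section_integrals.
Variables (R : realType) (m n : nat) (mu : {sigma_finite_measure set (borel_rV R m) -> \bar R}).
Hypothesis muE : (mu : set (borel_rV R m) -> \bar R) = lebesgue_rV R m.
Hypothesis muc : forall r : R, 0 <= r -> mu (cube r) = ((2 * r) ^+ m)%:E.
Variable B : 'M[R]_(m, n).
Hypothesis BB : B *m B^T = 1%:M.
Hypothesis m0 : (0 < m)%N.

Let D : set (borel_rV R m) := @punctured_ball R m.

Lemma mulmx_orthonormal_neq0 (y : 'rV[R]_m) : (y *m B != 0) = (y != 0).
Proof. by rewrite -!enorm_gt0 enorm_mulmx. Qed.

Lemma measurable_radial_mulmx (M : 'rV[R]_n -> R) : gauge M ->
  measurable_fun setT (fun y : borel_rV R m => radial_function M (y *m B)).
Proof.
by move=> gM; apply: (measurableT_comp (measurable_radial gM)); exact: measurable_mulmxr.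
Qed.

(** The section is, up to the origin, the set of the y with |y| <= rho (y *m B), where
    rho is the radial function; [polar_volume] applies. *)
Lemma section_volume (M : 'rV[R]_n -> R) : gauge M ->
  fine (mu [set y | M (y *m B) <= 1]) = \int[mu]_(y in D) (radial_function M (y *m B) ^+ m).
Proof.
move=> gM; have [a [b [a0 b0 rab]]] := radial_bounds gM.
pose g (y : 'rV[R]_m) := radial_function M (y *m B).
have gZ t y : 0 < t -> g (t *: y) = g y.
  by move=> t0; rewrite /g -scalemxAl radialZ.
have mg : measurable_fun [set: borel_rV R m] g by exact: measurable_radial_mulmx.
have muZ (t : R) (A : set (borel_rV R m)) : 0 < t -> measurable A ->
  (mu [set x | A (t *: (x : 'rV[R]_m))] = (t ^- m)%:E * mu A)%E.
  by move=> t0 mA; rewrite muE; exact: lebesgue_rV_scale.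
have mrad : measurable ([set y | 0 < enorm y <= g y] : set (borel_rV R m)).
  rewrite (_ : [set _ | _] = (@enorm R m @^-1` `]0, +oo[%classic) `&`
   ((fun x => g x - enorm x) @^-1` `[0, +oo[%classic)).
    apply: (@measurableI _ (borel_rV R m)); rewrite -[X in measurable X]setTI.
      by apply: measurable_enorm => //; exact: measurable_itv.
    have : measurable_fun [set: borel_rV R m] (fun x => g x - enorm x).
      by apply: measurable_funB => //; exact: measurable_enorm.
    by apply => //; exact: measurable_itv.
  by apply/seteqP; split=> x /=; rewrite !in_itv/= !andbT subr_ge0 => /andP.
have -> : [set y | M (y *m B) <= 1] = [set y | 0 < enorm y <= g y] `|` [set 0].
  apply/seteqP; split=> y /=.
    have [->|y0] := eqVneq y 0; first by right.
    move=> My; left; rewrite enorm_gt0 y0 /g /radial_function enorm_mulmx//=.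
    have My0 : 0 < M (y *m B) by apply: gauge_gt0; rewrite ?mulmx_orthonormal_neq0.
    by rewrite ler_pdivlMr// ler_piMr// enorm_ge0.
  move=> [/andP[y0 yg]|->]; last by rewrite mul0mx gauge0.
  have My0 : 0 < M (y *m B).
    by apply: gauge_gt0 => //; rewrite mulmx_orthonormal_neq0 -enorm_gt0.
  move: yg; rewrite /g /radial_function enorm_mulmx// ler_pdivlMr//.
  by rewrite -[leRHS]mulr1 ler_pM2l.
rewrite (lebesgue_add_zero muc)//.
rewrite (polar_volume muZ mg gZ m0 (punctured_ball_lt_pinfty muc) a0 b0)//.
by move=> y y0; apply: rab; rewrite mulmx_orthonormal_neq0.
Qed.

Lemma section_surface_integral (T : set 'rV[R]_n) (f : 'rV[R]_n -> R) (b : R) :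
  (forall y : 'rV[R]_m, T (y *m B)) -> (forall t x, T x -> T (t *: x)) ->
  measurable (T : set (borel_rV R n)) ->
  measurable_fun [set: borel_rV R n] f -> (forall x, enorm x = 1 -> `|f x| <= b) ->
  fine (\int[surface_measure m (pushforward mu
      (fun y : borel_rV R m => ((y : 'rV[R]_m) *m B : borel_rV R n)))]_(x in
      (euclidean_sphere R n `&` T : set (borel_rV R n))) (f x)%:E)%E =
  m%:R * \int[mu]_(y in D) f (direction B y).
Proof.
move=> TB TZ mT mf fb.
have dE (y : borel_rV R m) : D y -> f (direction B y) = f (ball_direction B y).
  by move=> Dy; rewrite /ball_direction indicE mem_set// scale1r.
have intf : mu.-integrable D (EFin \o (fun y => f (direction B y))).
  have : mu.-integrable D (EFin \o (fun y => f (ball_direction B y))).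
    apply: (@bounded_integrable _ _ _ _ _ _ _ _ b).
    - exact: measurable_punctured_ball.
    - exact: (punctured_ball_lt_pinfty muc).
    - exact: (measurableT_comp mf (measurable_ball_direction B)).
    - move=> y Dy; rewrite -dE//; apply: fb; apply: enorm_direction => //.
      by case/andP: Dy.
  apply: eq_integrable; first exact: measurable_punctured_ball.
  by move=> y /set_mem Dy /=; rewrite dE.
rewrite surface_measure_integral// fineM//.
by have := integrable_fin_num (@measurable_punctured_ball R m) intf.
Qed.

End section_integrals.

Lemma radon_integral (R : realType) (m n : nat)
    (mu : {sigma_finite_measure set (borel_rV R m) -> \bar R})
    (muE : (mu : set (borel_rV R m) -> \bar R) = lebesgue_rV R m)
    (muc : forall r : R, 0 <= r -> mu (cube r) = ((2 * r) ^+ m)%:E)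
    (H : grassmannian R n m) (f : 'rV[R]_n -> R) (b : R) :
  measurable_fun [set: borel_rV R n] f -> (forall x, enorm x = 1 -> `|f x| <= b) ->
  radon f H = m%:R * \int[mu]_(y in (@punctured_ball R m : set (borel_rV R m)))
    f (direction (xget 0 (orthonormal_basis H)) y).
Proof.
move=> mf fb; have [BB BH] := orthonormal_basis_neq0 H.
rewrite /radon /lebesgue_sub -muE.
apply: (section_surface_integral muc BB _ _ _ mf fb) => [y|t x|].
- exact: mulmx_in_vspace.
- exact: memvZ.
- exact: measurable_gset.
Qed.

Lemma vol_sub_integral (R : realType) (m n : nat)
    (mu : {sigma_finite_measure set (borel_rV R m) -> \bar R})
    (muE : (mu : set (borel_rV R m) -> \bar R) = lebesgue_rV R m)
    (muc : forall r : R, 0 <= r -> mu (cube r) = ((2 * r) ^+ m)%:E)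
    (H : grassmannian R n m) (K : set 'rV[R]_n) : (0 < m)%N -> star_body K ->
  vol_sub H (K `&` gset H) =
  \int[mu]_(y in (@punctured_ball R m : set (borel_rV R m)))
    (radial_function (minkowski_functional K) (y *m xget 0 (orthonormal_basis H)) ^+ m).
Proof.
move=> m0 sK; have [BB BH] := orthonormal_basis_neq0 H.
rewrite -(section_volume muE muc BB m0 (gauge_minkowski sK)).
rewrite /vol_sub /lebesgue_sub -muE /pushforward; congr (fine (mu _)).
apply/seteqP; split=> y /=; first by rewrite {1}(minkowski_le1 sK) => -[].
by move=> My; split; [rewrite (minkowski_le1 sK)|exact: mulmx_in_vspace].
Qed.

Lemma mulmx1_identity (R : realType) (n : nat) :
  (fun y : borel_rV R n => ((y : 'rV[R]_n) *m 1%:M : borel_rV R n)) = id.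
Proof. by apply/funext => y; rewrite mulmx1. Qed.

Lemma sphere_integralE (R : realType) (n : nat)
    (mu : {sigma_finite_measure set (borel_rV R n) -> \bar R})
    (muE : (mu : set (borel_rV R n) -> \bar R) = lebesgue_rV R n)
    (muc : forall r : R, 0 <= r -> mu (cube r) = ((2 * r) ^+ n)%:E)
    (f : 'rV[R]_n -> R) (b : R) :
  measurable_fun [set: borel_rV R n] f -> (forall x, enorm x = 1 -> `|f x| <= b) ->
  sphere_integral f = n%:R * \int[mu]_(y in (@punctured_ball R n : set (borel_rV R n)))
    f (direction 1%:M y).
Proof.
move=> mf fb; have BB : (1%:M : 'M[R]_n) *m 1%:M^T = 1%:M by rewrite trmx1 mulmx1.
rewrite -(section_surface_integral muc BB (T := setT) _ _ _ mf fb)//.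
by rewrite mulmx1_identity setIT /sphere_integral -muE.
Qed.

Lemma vol_integral (R : realType) (n : nat)
    (mu : {sigma_finite_measure set (borel_rV R n) -> \bar R})
    (muE : (mu : set (borel_rV R n) -> \bar R) = lebesgue_rV R n)
    (muc : forall r : R, 0 <= r -> mu (cube r) = ((2 * r) ^+ n)%:E)
    (K : set 'rV[R]_n) : (0 < n)%N -> star_body K ->
  vol K = \int[mu]_(y in (@punctured_ball R n : set (borel_rV R n)))
    (radial_function (minkowski_functional K) y ^+ n).
Proof.
move=> n0 sK; have BB : (1%:M : 'M[R]_n) *m 1%:M^T = 1%:M by rewrite trmx1 mulmx1.
have := section_volume muE muc BB n0 (gauge_minkowski sK).
under eq_Rintegral do rewrite mulmx1.
move=> <-; rewrite /vol -muE {1}(minkowski_le1 sK); congr (fine (mu _)).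
by apply/seteqP; split=> y /=; rewrite mulmx1.
Qed.

(** * Volumes of star bodies and gaps between their sections *)

Lemma gauge_inv_power_continuous (R : realType) (n j : nat) (M : 'rV[R]_n -> R) (x : 'rV[R]_n) :
  gauge M -> x != 0 -> {for x, continuous (fun y => (M y)^-1 ^+ j)}.
Proof.
move=> gM x0; have [cM _ _ _] := gM.
have Mx0 : M x != 0 by rewrite gt_eqF// gauge_gt0.
apply: (@continuous_comp _ _ _ (fun y => (M y)^-1) (fun a : R => a ^+ j)).
  apply: (@cvgV _ _ (nbhs x) _ M (M x)) => //.
  exact: cM.
exact: exprn_continuous.
Qed.

Lemma gauge_inv_bounds (R : realType) (n : nat) (M : 'rV[R]_n -> R) (b : R) (x : 'rV[R]_n) :
  gauge M -> (forall z, z != 0 -> radial_function M z <= b) -> enorm x = 1 -> 0 <= (M x)^-1 <= b.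
Proof.
move=> gM hb x1; have x0 : x != 0 by rewrite -enorm_gt0 x1.
rewrite invr_ge0 gauge_ge0//=; have := hb _ x0.
by rewrite /radial_function x1 div1r.
Qed.

Lemma vol_gt0 (R : realType) (n : nat) (K : set 'rV[R]_n) :
  (0 < n)%N -> star_body K -> 0 < vol K.
Proof.
move=> n0 sK; have [mu muE muc] := lebesgue_rV_sigma_finite_cube R n.
have gK := gauge_minkowski sK.
have [a [b [a0 b0 rab]]] := radial_bounds gK.
rewrite (vol_integral muE muc n0 sK).
have Dfin := punctured_ball_lt_pinfty muc.
have mD := @measurable_punctured_ball R n.
apply: (@lt_le_trans _ _ (\int[mu]_(y in (@punctured_ball R n : set (borel_rV R n))) (a ^+ n))).
  rewrite Rintegral_cst// mulr_gt0 ?exprn_gt0//.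
  by rewrite -(vol_euclidean_ball muE muc n0) (vol_euclidean_ball_gt0 muE muc n0).
apply: le_Rintegral => //.
- exact: (@bounded_integrable _ _ _ _ _ mD Dfin _ `|a ^+ n|).
- apply: (@bounded_integrable _ _ _ _ _ mD Dfin _ (b ^+ n)).
    by apply: measurable_funX; exact: measurable_radial.
  move=> x /andP[x0 _]; rewrite enorm_gt0 in x0; have /andP[ax xb] := rab _ x0.
  have r0 := le_trans (ltW a0) ax.
  by rewrite ger0_norm ?exprn_ge0//; apply: lerXn2r; rewrite ?nnegrE.
- move=> x /andP[x0 _]; rewrite enorm_gt0 in x0; have /andP[ax xb] := rab _ x0.
  by apply: lerXn2r; rewrite ?nnegrE ?(ltW a0)// (le_trans (ltW a0)).
Qed.

Definition section_gaps (R : realType) (n m : nat) (K L : set 'rV[R]_n) : set R :=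
  [set `| vol_sub H (K `&` gset H) - vol_sub H (L `&` gset H) |
        | H in [set: grassmannian R n m]].

(** Without this bound the supremum would be 0 by convention. *)
Lemma section_gaps_has_ubound (R : realType) (n m : nat) (K L : set 'rV[R]_n) :
  (0 < m)%N -> star_body K -> star_body L -> has_ubound (section_gaps m K L).
Proof.
move=> m0 sK sL; have [mu muE muc] := lebesgue_rV_sigma_finite_cube R m.
suff bnd (N : set 'rV[R]_n) : star_body N ->
    exists b, forall H : grassmannian R n m, `|vol_sub H (N `&` gset H)| <= b.
  have [b hb] := bnd _ sK; have [c hc] := bnd _ sL.
  exists (b + c) => _ [H _ <-]; apply: le_trans (ler_normB _ _) _.
  exact: lerD.
move=> sN; have gN := gauge_minkowski sN.
have [a [b [a0 b0 rab]]] := radial_bounds gN.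
have Dfin := punctured_ball_lt_pinfty muc.
have mD := @measurable_punctured_ball R m.
exists (\int[mu]_(y in (@punctured_ball R m : set (borel_rV R m))) (b ^+ m)) => H.
have [BB _] := orthonormal_basis_neq0 H.
rewrite (vol_sub_integral muE muc H m0 sN).
set B := xget 0 (orthonormal_basis H) in BB *.
have rB (y : borel_rV R m) : @punctured_ball R m y ->
    0 <= radial_function (minkowski_functional N) ((y : 'rV[R]_m) *m B) <= b.
  move=> /andP[y0 _]; rewrite enorm_gt0 -(mulmx_orthonormal_neq0 BB) in y0.
  by have /andP[h1 ->] := rab _ y0; rewrite (le_trans (ltW a0) h1).
rewrite ger0_norm; last by apply: Rintegral_ge0 => y /rB /andP[h _]; exact: exprn_ge0.
apply: le_Rintegral => //.
- apply: (@bounded_integrable _ _ _ _ _ mD Dfin _ (b ^+ m)).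
    by apply: measurable_funX; exact: measurable_radial_mulmx.
  move=> y /rB /andP[h hb]; rewrite ger0_norm ?exprn_ge0//.
  by apply: lerXn2r; rewrite ?nnegrE.
- exact: (@bounded_integrable _ _ _ _ _ mD Dfin _ `|b ^+ m|).
- by move=> y /rB /andP[h hb]; apply: lerXn2r; rewrite ?nnegrE.
Qed.

Lemma sup_section_gaps_ge0 (R : realType) (n m : nat) (K L : set 'rV[R]_n) :
  has_ubound (section_gaps m K L) -> 0 <= sup (section_gaps m K L).
Proof.
move=> ub; have [->|/set0P [x Sx]] := eqVneq (section_gaps m K L) set0.
  by rewrite sup0.
by apply: le_trans (ub_le_sup ub Sx); case: Sx => H _ <-.
Qed.

(** * The comparison of volumes *)

(** The functional nu of K is positive, and the function f below has nonnegative
    Radon transform; so f has nonnegative integral against rho_K^k, which is an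
    inequality between volumes once Hoelder's inequality is applied. *)
Lemma le_of_section_gaps (R : realType) (n k : nat) (K L : set 'rV[R]_n) :
  (1 <= k)%N -> (k < n)%N -> star_body K -> star_body L ->
  generalized_intersection_body k K ->
  vol K `^ ((n - k)%:R / n%:R) <= vol L `^ ((n - k)%:R / n%:R) +
    vol (euclidean_ball R n) `^ ((n - k)%:R / n%:R) / vol (euclidean_ball R (n - k)%N) *
    sup (section_gaps (n - k) K L).
Proof.
move=> k1 kn sK sL [nu [_ _ nu_pos] nuE].
set m := (n - k)%N; have m0 : (0 < m)%N by rewrite subn_gt0.
have nE : (k + m)%N = n by rewrite subnKC// ltnW.
have n0 : (0 < n)%N by exact: leq_ltn_trans kn.
set s := sup _.
have ub := section_gaps_has_ubound m0 sK sL.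
have s0 : 0 <= s := sup_section_gaps_ge0 ub.
have [mu muE muc] := lebesgue_rV_sigma_finite_cube R n.
have [la laE lac] := lebesgue_rV_sigma_finite_cube R m.
have gK := gauge_minkowski sK; have gL := gauge_minkowski sL.
set MK := minkowski_functional K in gK *; set ML := minkowski_functional L in gL *.
have [aK [bK [aK0 bK0 rK]]] := radial_bounds gK.
have [aL [bL [aL0 bL0 rL]]] := radial_bounds gL.
pose V := vol (euclidean_ball R n); pose W := vol (euclidean_ball R m).
have V0 : 0 < V := vol_euclidean_ball_gt0 muE muc n0.
have W0 : 0 < W := vol_euclidean_ball_gt0 laE lac m0.
(* With this constant, the Radon transform of c at H is m s, since the unit ball
   of H has volume W. *)
pose c := s / W.
have c0 : 0 <= c by rewrite divr_ge0// ltW.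
pose f (x : 'rV[R]_n) := c + (ML x)^-1 ^+ m - (MK x)^-1 ^+ m.
have mKi := measurable_gauge_inv gK; have mLi := measurable_gauge_inv gL.
have mf : measurable_fun [set: borel_rV R n] f.
  apply: measurable_funB; last exact: measurable_funX.
  by apply: measurable_funD => //; exact: measurable_funX.
have iK x : enorm x = 1 -> 0 <= (MK x)^-1 <= bK.
  by apply: gauge_inv_bounds => // z /rK /andP[].
have iL x : enorm x = 1 -> 0 <= (ML x)^-1 <= bL.
  by apply: gauge_inv_bounds => // z /rL /andP[].
have powb (u b : R) j : 0 <= u <= b -> `|u ^+ j| <= b ^+ j.
  move=> /andP[u0 ub']; rewrite ger0_norm ?exprn_ge0//.
  by apply: lerXn2r; rewrite ?nnegrE// (le_trans u0).
have fb x : enorm x = 1 -> `|f x| <= c + bL ^+ m + bK ^+ m.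
  move=> x1; rewrite /f (le_trans (ler_normB _ _))// lerD ?powb ?iK//.
  by rewrite (le_trans (ler_normD _ _))// ger0_norm// lerD2l powb ?iL.
have cf : sphere_continuous R n f.
  apply: continuous_in_subspaceT => x /set_mem x1.
  have x0 : x != 0 by rewrite -enorm_gt0 x1.
  have hK := gauge_inv_power_continuous (j := m) gK x0.
  have hL := gauge_inv_power_continuous (j := m) gL x0.
  exact: cvgB (cvgD (cvg_cst c) hL) hK.
have mDm := @measurable_punctured_ball R m; have mDn := @measurable_punctured_ball R n.
have laD := punctured_ball_lt_pinfty lac; have muD := punctured_ball_lt_pinfty muc.
(* It equals m (s + Vol(L cap H) - Vol(K cap H)). *)
have radon_ge0 (H : grassmannian R n m) : 0 <= radon f H.
  have [BB _] := orthonormal_basis_neq0 H.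
  rewrite (radon_integral laE lac H mf fb) mulr_ge0//.
  set B := xget 0 (orthonormal_basis H) in BB *.
  have intX (M : 'rV[R]_n -> R) (b : R) : gauge M ->
      (forall x, enorm x = 1 -> 0 <= (M x)^-1 <= b) ->
      la.-integrable (@punctured_ball R m : set (borel_rV R m))
        (EFin \o (fun y => radial_function M (y *m B) ^+ m)).
    move=> gM hM; apply: (@bounded_integrable _ _ _ _ _ mDm laD _ (b ^+ m)).
      by apply: measurable_funX; exact: measurable_radial_mulmx.
    move=> y Dy; rewrite -(gauge_direction gM BB Dy) powb// hM// enorm_direction//.
    by case/andP: Dy.
  have intK := intX _ _ gK iK; have intL := intX _ _ gL iL.
  have intc : la.-integrable (@punctured_ball R m : set (borel_rV R m)) (EFin \o cst c).
    exact: (@bounded_integrable _ _ _ _ _ mDm laD _ `|c|).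
  rewrite (@eq_Rintegral _ _ _ la _
    (fun y => c + radial_function ML (y *m B) ^+ m - radial_function MK (y *m B) ^+ m)); last first.
    move=> y /set_mem Dy; rewrite /f.
    by rewrite (gauge_direction gL BB Dy) (gauge_direction gK BB Dy).
  rewrite RintegralB//; last exact: integrable_add.
  rewrite RintegralD// Rintegral_cst// -(vol_euclidean_ball laE lac m0).
  rewrite -/W /c divfK ?gt_eqF//.
  rewrite -(vol_sub_integral laE lac H m0 sK) -(vol_sub_integral laE lac H m0 sL).
  rewrite -addrA -opprB subr_ge0; apply: le_trans (ler_norm _) _.
  by apply: (ub_le_sup ub); exists H.
(* In terms of the integral over the ball: 0 <= int rho_K^k (c + rho_L^m - rho_K^m). *)
have : 0 <= nu (radon f) by apply: nu_pos => //; exists f.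
rewrite -nuE// (sphere_integralE muE muc (b := bK ^+ k * (c + bL ^+ m + bK ^+ m))); last 2 first.
- apply: measurable_funM => //.
  by under eq_fun do rewrite -exprVn; exact: measurable_funX.
- by move=> x x1; rewrite normrM ler_pM// ?fb// -exprVn powb// iK.
rewrite pmulr_rge0 ?ltr0n//.
have BB : (1%:M : 'M[R]_n) *m 1%:M^T = 1%:M by rewrite trmx1 mulmx1.
set D : set (borel_rV R n) := @punctured_ball R n in mDn muD *.
pose u (y : borel_rV R n) := radial_function MK y.
pose v (y : borel_rV R n) := radial_function ML y.
pose b := Num.max 1 (Num.max bK bL).
have ub' y : D y -> 0 <= u y <= b.
  move=> /andP[y0 _]; rewrite enorm_gt0 in y0; have /andP[h1 h2] := rK _ y0.
  by rewrite (le_trans (ltW aK0) h1)/= /b !le_max h2 orbT.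
have vb' y : D y -> 0 <= v y <= b.
  move=> /andP[y0 _]; rewrite enorm_gt0 in y0; have /andP[h1 h2] := rL _ y0.
  by rewrite (le_trans (ltW aL0) h1)/= /b !le_max h2 !orbT.
(* The constant function 1 is the radial function of the ball, so that the term
   with c is also of the form required by Hoelder's inequality. *)
have ob' y : D y -> 0 <= (cst 1 : borel_rV R n -> R) y <= b.
  by move=> _; rewrite /= ler01 /b le_max lexx.
have mu' : measurable_fun setT u by exact: measurable_radial.
have mv' : measurable_fun setT v by exact: measurable_radial.
have intM (g : borel_rV R n -> R) (i j : nat) : measurable_fun setT g ->
    (forall y, D y -> 0 <= g y <= b) ->
    mu.-integrable D (EFin \o (fun y => u y ^+ i * g y ^+ j)).
  move=> mg gb; apply: (@bounded_integrable _ _ _ _ _ mDn muD _ (b ^+ i * b ^+ j)).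
    by apply: measurable_funM; exact: measurable_funX.
  by move=> y Dy; rewrite normrM ler_pM// powb// ?ub' ?gb.
rewrite (@eq_Rintegral _ _ _ mu _
    (fun y => c * (u y ^+ k * (cst 1 : borel_rV R n -> R) y ^+ m) +
              u y ^+ k * v y ^+ m - u y ^+ k * u y ^+ m)); last first.
  move=> y /set_mem Dy; rewrite -exprVn /f.
  rewrite (gauge_direction gL BB Dy) (gauge_direction gK BB Dy) mulmx1 -/(u y) -/(v y).
  by rewrite /= expr1n; ring.
have mo : measurable_fun setT (cst 1 : borel_rV R n -> R) by exact: measurable_cst.
have i1 := intM _ k m mo ob'.
have iv := intM _ k m mv' vb'; have iu := intM _ k m mu' ub'.
rewrite RintegralB//; last by apply: integrable_add => //; apply: integrable_scale.
rewrite RintegralD//; last exact: integrable_scale.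
rewrite RintegralZl// subr_ge0.
have VK : \int[mu]_(y in D) (u y ^+ (k + m)) = vol K by rewrite nE (vol_integral muE muc n0 sK).
have VL : \int[mu]_(y in D) (v y ^+ (k + m)) = vol L by rewrite nE (vol_integral muE muc n0 sL).
have V1 : \int[mu]_(y in D) ((cst 1 : borel_rV R n -> R) y ^+ (k + m)) = V.
  under eq_Rintegral do rewrite /= expr1n.
  by rewrite Rintegral_cst// mul1r /V (vol_euclidean_ball muE muc n0).
have -> : \int[mu]_(y in D) (u y ^+ k * u y ^+ m) = vol K.
  by rewrite -VK; apply: eq_Rintegral => y _; rewrite exprD.
have K0 := vol_gt0 n0 sK; have L0 := vol_gt0 n0 sL.
have hL := Rintegral_hoelder mDn muD k1 m0 mu' mv' ub' vb'.
have h1 := Rintegral_hoelder mDn muD k1 m0 mu' mo ub' ob'.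
rewrite VK VL nE in hL; rewrite VK V1 nE in h1.
move=> le1.
have le2 : vol K <= vol K `^ (k%:R / n%:R) *
    (vol L `^ (m%:R / n%:R) + c * V `^ (m%:R / n%:R)).
  apply: (le_trans le1); rewrite addrC mulrDr mulrCA lerD ?hL//.
  by rewrite ler_wpM2l ?h1.
(* Division by Vol(K)^(k/n) turns the exponent 1 of Vol(K) into m/n. *)
have KE : vol K = vol K `^ (k%:R / n%:R) * vol K `^ (m%:R / n%:R).
  rewrite -powRD; last by rewrite (gt_eqF K0) implybT.
  by rewrite -mulrDl -natrD nE mulfV ?powRr1 ?(ltW K0)// pnatr_eq0 -lt0n.
rewrite {1}KE ler_pM2l ?powR_gt0// in le2.
by apply: (le_trans le2); rewrite lerD2l /c -mulrA mulrC -mulrA [W^-1 * _]mulrC mulrA.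
Qed.

Theorem corollary3 (R : realType) (n k : nat) (K L : set 'rV[R]_n) :
  (1 <= k)%N -> (k < n)%N ->
  star_body K -> origin_symmetric K ->
  star_body L -> origin_symmetric L ->
  generalized_intersection_body k K ->
  generalized_intersection_body k L ->
  `| vol K `^ ((n - k)%:R / n%:R) - vol L `^ ((n - k)%:R / n%:R) | <=
    vol (euclidean_ball R n) `^ ((n - k)%:R / n%:R)
      / vol (euclidean_ball R (n - k)%N) *
    sup [set `| vol_sub H (K `&` gset H) - vol_sub H (L `&` gset H) |
        | H in [set: grassmannian R n (n - k)%N]].
Proof.
move=> k1 kn sK _ sL _ gK gL.
have KL := le_of_section_gaps k1 kn sK sL gK.
have LK := le_of_section_gaps k1 kn sL sK gL.
have gapsC : section_gaps (n - k) L K = section_gaps (n - k) K L.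
  by rewrite /section_gaps; congr image; apply/funext => H; rewrite distrC.
rewrite gapsC in LK.
by rewrite ler_norml lerBlDl KL andbT lerBrDl lerBlDr.
Qed.
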